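(* Let $R$ be a commutative ring and let $S\subseteq R$ be a multiplicative system. For any $1\leq n\leq\infty$, the map $\operatorname{colim}_{tS} G(T_s,n)\to G(R\text{ on }S,n)$ induced by sending the class of a $T_s$-module to the class of its underlying chain complex of $R$-modules is an isomorphism.
   Context: All chain complexes vanish in negative degrees. $\mathcal{P}(R)$ denotes the category of bounded chain complexes $P_\bullet$ of $R$-modules such that $P_i=0$ for $i<0$ and each $P_i$ is a finitely-generated projective $R$-module. For an integer $n\geq 0$, $\mathcal{P}(R,n)$ is the full subcategory of complexes with $P_i=0$ for $i\notin[0,n]$; $\mathcal{P}(R,\infty)=\mathcal{P}(R)$. $G(R\text{ on }S,n)$ is the quotient of the free abelian group on the isomorphism classes of objects $P_\bullet$ of $\mathcal{P}(R,n)$ such that $S^{-1}P_\bullet$ is exact, by the relations (1) $[P_\bullet]=[P'_\bullet]+[P''_\bullet]$ for every short exact sequence $0\to P'_\bullet\to P_\bullet\to P''_\bullet\to 0$ of such complexes; (2) $[P_\bullet]=0$ if $H_*(P_\bullet)=0$. For $s\in R$, $T_s$ is the DGA over $R$ with underlying graded algebra $R[e]$, $\deg e=1$, with differential determined by $de=s$ (so $d(e^m)=0$ for $m$ even and $d(e^m)=se^{m-1}$ for $m$ odd). Giving a left $T_s$-module structure on a chain complex $C$ of $R$-modules (extending the $R$-structure) is the same as giving an $R$-linear null-homotopy $e\colon C_i\to C_{i+1}$ (all $i$) with $d(e.x)+e.(dx)=sx$. $\mathcal{P}(T_s,n)$ is the category of dg-modules over $T_s$ whose underlying chain complex lies in $\mathcal{P}(R,n)$.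 $G(T_s,n)$ is the quotient of the free abelian group on isomorphism classes of objects of $\mathcal{P}(T_s,n)$ by the relations (1) $[X]=[X']+[X'']$ for every short exact sequence $0\to X'\to X\to X''\to 0$ in $\mathcal{P}(T_s,n)$; (2) $[X]=0$ if $H_*(X)=0$. $tS$ is the category whose objects are the elements of $S$ and whose morphisms from $s$ to $t$ are the $x\in S$ with $sx=t$ (it is filtered). For $s,t\in R$ there is a DGA map $T_{st}\to T_s$ sending $e\mapsto te$; restriction of scalars along it induces $j\colon G(T_s,n)\to G(T_{st},n)$. These maps make $s\mapsto G(T_s,n)$ into a functor from $tS$ to abelian groups (the morphism $t\colon s\to st$ acting as $j$), and the colimit is that of this functor. For $s\in S$, the underlying complex of a $T_s$-module becomes exact after localizing at $S$, giving the homomorphisms $G(T_s,n)\to G(R\text{ on }S,n)$ that define the map in the claim. *)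

(* Defs.v *)
From HB Require Import structures.
From mathcomp Require Import all_boot all_order all_algebra.
From mathcomp Require Import generic_quotient ring_quotient.
From mathcomp Require Import ring boolp.
From mathcomp Require Import freeg.

Set Implicit Arguments.
Unset Strict Implicit.
Unset Printing Implicit Defensive.
Import GRing.Theory.
Local Open Scope ring_scope.
Local Open Scope quotient_scope.

Section Modules.
Variable R : comPzRingType.

Definition comb (M : lmodType R) n (g : 'I_n -> M) (v : 'I_n -> R) : M :=
  \sum_j v j *: g j.

Definition generates (M : lmodType R) n (g : 'I_n -> M) : Prop :=
  forall x, exists v, comb g v = x.

Definition fin_gen (M : lmodType R) : Prop :=
  exists n (g : 'I_n -> M), generates g.

Definition projective (P : lmodType R) : Prop :=
  forall (M N : lmodType R) (p : {linear M -> N}) (f : {linear P -> N}),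
    (forall y, exists x, p x = y) ->
    exists h : {linear P -> M}, forall x, p (h x) = f x.

Definition zero_mod (M : lmodType R) : Prop := forall x : M, x = 0.

Lemma combB (M : lmodType R) n (g : 'I_n -> M) v w :
  comb g (fun j => v j - w j) = comb g v - comb g w.
Proof.
by rewrite /comb -sumrB; apply: eq_bigr => j _; rewrite scalerBl.
Qed.

Lemma combP (M : lmodType R) n (g : 'I_n -> M) a v w :
  comb g (fun j => a * v j + w j) = a *: comb g v + comb g w.
Proof.
rewrite /comb scaler_sumr -big_split /=; apply: eq_bigr => j _.
by rewrite scalerDl scalerA.
Qed.

Lemma comb_lin (M N : lmodType R) (f : {linear M -> N}) n (g : 'I_n -> M) v :
  f (comb g v) = comb (fun j => f (g j)) v.
Proof. by rewrite /comb linear_sum; apply: eq_bigr => j _; rewrite linearZ. Qed.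

End Modules.

(** Complexes vanish in negative degrees, so they are indexed by [nat]. *)
Record cplx (R : comPzRingType) := Cplx {
  cmod :> nat -> lmodType R;
  cdiff : forall i, {linear cmod i.+1 -> cmod i};
  cdiff_sq : forall i x, cdiff i (cdiff i.+1 x) = 0 }.

Record cmap (R : comPzRingType) (X Y : cplx R) := Cmap {
  cmap_fun :> forall i, {linear X i -> Y i};
  cmap_diff : forall i x, cmap_fun i (cdiff X i x) = cdiff Y i (cmap_fun i.+1 x) }.

Section Complexes.
Variable R : comPzRingType.
Implicit Types X Y Z : cplx R.

(** The differential out of degree [i], including the zero map out of degree
    0, whose target is here the irrelevant [X 0]. *)
Definition bdiff X i : X i -> X i.-1 :=
  match i with 0 => fun=> 0 | k.+1 => cdiff X k end.

(** [H_i X = 0] for all [i]; out of degree 0 every element is a cycle. *)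
Definition acyclic X : Prop :=
  (forall x : X 0, exists y, cdiff X 0 y = x) /\
  (forall i (x : X i.+1), cdiff X i x = 0 -> exists y, cdiff X i.+1 y = x).

Definition cplx_iso X Y : Prop :=
  exists (f : cmap X Y) (g : cmap Y X), forall i, cancel (f i) (g i) /\ cancel (g i) (f i).

Definition degreewise_exact (X Y Z : nat -> lmodType R)
    (f : forall i, {linear X i -> Y i}) (g : forall i, {linear Y i -> Z i}) : Prop :=
  forall i, [/\ injective (f i),
                forall y, g i y = 0 <-> exists x, f i x = y
              & forall z, exists y, g i y = z].

Definition cplx_ses X Y Z : Prop :=
  exists (f : cmap X Y) (g : cmap Y Z), degreewise_exact f g.

(** Bounds [0 <= n <= oo]; [None] stands for [oo]. *)
Definition leq_oo (i : nat) (n : option nat) : bool :=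
  if n is Some m then (i <= m)%N else true.

Definition in_P (n : option nat) X : Prop :=
  [/\ forall i, fin_gen (X i) /\ projective (X i),
      exists N, forall i, (N < i)%N -> zero_mod (X i)
    & forall i, ~~ leq_oo i n -> zero_mod (X i)].

End Complexes.

Section Localization.
Variables (R : comPzRingType) (S : mulrClosed R).

Definition mset : Type := {s : R | s \in S}.

Definition mset1 : mset := exist _ 1 (rpred1 S).
Definition msetM (s t : mset) : mset :=
  exist _ (sval s * sval t) (rpredM (svalP s) (svalP t)).

Variable M : lmodType R.

Definition frac_rel (p q : M * mset) : bool :=
  `[< exists u : mset, sval u *: (sval q.2 *: p.1) = sval u *: (sval p.2 *: q.1) >].

Lemma frac_rel_equiv : equiv_class_of frac_rel.
Proof.
split=> [p|p q|q p r].
- by apply/asboolP; exists mset1.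
- by apply/asboolP/asboolP => -[u e]; exists u.
- move=> /asboolP[u e] /asboolP[v e']; apply/asboolP.
  exists (msetM (msetM u v) q.2) => /=.
  have -> : (sval u * sval v * sval q.2) *: (sval r.2 *: p.1) =
      (sval v * sval r.2) *: (sval u *: (sval q.2 *: p.1)).
    by rewrite !scalerA; congr (_ *: _); ring.
  rewrite e.
  have -> : (sval u * sval v * sval q.2) *: (sval p.2 *: r.1) =
      (sval u * sval p.2) *: (sval v *: (sval q.2 *: r.1)).
    by rewrite !scalerA; congr (_ *: _); ring.
  by rewrite -e' !scalerA; congr (_ *: _); ring.
Qed.

Canonical frac_equiv := EquivRelPack frac_rel_equiv.
Canonical frac_encModRel := defaultEncModRel frac_rel.

Definition loc : Type := {eq_quot frac_rel}.

Definition frac (x : M) (s : mset) : loc := \pi_loc (x, s).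

Lemma frac_eq x s y t :
  frac x s = frac y t <-> exists u : mset, sval u *: (sval t *: x) = sval u *: (sval s *: y).
Proof. by split=> [/eqmodP/asboolP|h]; last exact/eqmodP/asboolP. Qed.

Lemma fracP (z : loc) : exists x s, z = frac x s.
Proof. by elim/quotW: z => -[x s]; exists x, s. Qed.

Lemma frac_repr (z : loc) : frac (repr z).1 (repr z).2 = z.
Proof. by rewrite /frac -surjective_pairing reprK. Qed.

Definition loc0 : loc := frac 0 mset1.
Definition locN (z : loc) : loc := frac (- (repr z).1) (repr z).2.
Definition locD (z w : loc) : loc :=
  frac (sval (repr w).2 *: (repr z).1 + sval (repr z).2 *: (repr w).1)
       (msetM (repr z).2 (repr w).2).
Definition locZ (a : R) (z : loc) : loc := frac (a *: (repr z).1) (repr z).2.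

Lemma locNE x s : locN (frac x s) = frac (- x) s.
Proof.
have /frac_eq[u e] := frac_repr (frac x s).
by apply/frac_eq; exists u; rewrite !scalerN e.
Qed.

Lemma locZE a x s : locZ a (frac x s) = frac (a *: x) s.
Proof.
have /frac_eq[u e] := frac_repr (frac x s).
apply/frac_eq; exists u; move/(congr1 (fun z => a *: z)): e.
move: (repr _) => [x' s'] /=; rewrite !scalerA => e.
transitivity ((a * sval u * sval s) *: x'); first by congr (_ *: _); ring.
by rewrite e; congr (_ *: _); ring.
Qed.

Lemma locDE x s y t :
  locD (frac x s) (frac y t) = frac (sval t *: x + sval s *: y) (msetM s t).
Proof.
rewrite /locD; move: (frac_repr (frac x s)) (frac_repr (frac y t)).
move: (repr (frac x s)) (repr (frac y t)) => [x' s'] [y' t'] /=.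
move=> /frac_eq[u e] /frac_eq[v e'].
apply/frac_eq; exists (msetM u v) => /=.
rewrite !scalerDr; congr (_ + _).
  move/(congr1 (fun z => (sval v * sval t * sval t') *: z)): e.
  rewrite !scalerA => e.
  by transitivity ((sval v * sval t * sval t' * sval u * sval s) *: x');
    [congr (_ *: _); ring | rewrite e; congr (_ *: _); ring].
move/(congr1 (fun z => (sval u * sval s * sval s') *: z)): e'.
rewrite !scalerA => e'.
by transitivity ((sval u * sval s * sval s' * sval v * sval t) *: y');
  [congr (_ *: _); ring | rewrite e'; congr (_ *: _); ring].
Qed.

Ltac frac_tac := apply/frac_eq; exists mset1;
  rewrite /= ?scalerDr ?scalerDl ?scalerA.

Lemma locDA : associative locD.
Proof.
move=> a b c; case: (fracP a) (fracP b) (fracP c) => x [s ->] [y [t ->]] [z [w ->]].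
rewrite !locDE; frac_tac.
by rewrite addrA; congr (_ *: _ + _ *: _ + _ *: _); ring.
Qed.

Lemma locDC : commutative locD.
Proof.
move=> a b; case: (fracP a) (fracP b) => x [s ->] [y [t ->]].
rewrite !locDE; frac_tac.
by rewrite addrC; congr (_ *: _ + _ *: _); ring.
Qed.

Lemma loc0D : left_id loc0 locD.
Proof.
move=> a; case: (fracP a) => x [s ->]; rewrite /loc0 locDE scaler0 add0r; frac_tac.
by congr (_ *: _); ring.
Qed.

Lemma locND : left_inverse loc0 locN locD.
Proof.
move=> a; case: (fracP a) => x [s ->].
by rewrite /loc0 locNE locDE scalerN addNr; frac_tac; rewrite !scaler0.
Qed.

HB.instance Definition _ := Choice.on loc.
HB.instance Definition _ := GRing.isZmodule.Build loc locDA locDC loc0D locND.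

Lemma locZA a b z : locZ a (locZ b z) = locZ (a * b) z.
Proof. by case: (fracP z) => x [s ->]; rewrite !locZE scalerA. Qed.

Lemma loc1Z : left_id 1 locZ.
Proof. by move=> z; case: (fracP z) => x [s ->]; rewrite locZE scale1r. Qed.

Lemma locZDr : right_distributive locZ +%R.
Proof.
move=> a z w; case: (fracP z) (fracP w) => x [s ->] [y [t ->]].
rewrite [frac _ _ + _]locDE !locZE [RHS]locDE; frac_tac.
by congr (_ *: _ + _ *: _); ring.
Qed.

Lemma locZDl z : {morph locZ^~ z : a b / a + b}.
Proof.
move=> a b; case: (fracP z) => x [s ->].
rewrite !locZE [RHS]locDE -scalerDr -scalerDl; frac_tac.
by rewrite -!scalerDl; congr (_ *: _); ring.
Qed.

HB.instance Definition _ :=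
  GRing.Zmodule_isLmodule.Build R loc locZA loc1Z locZDr locZDl.

Lemma frac_eq0 x s : frac x s = 0 <-> exists u : mset, sval u *: x = 0.
Proof.
split=> [/frac_eq[u /=]|[u e]].
  by rewrite scale1r !scaler0 => e; exists u.
by apply/frac_eq; exists u; rewrite /= scale1r !scaler0.
Qed.

End Localization.

Section LocalizedComplex.
Variables (R : comPzRingType) (S : mulrClosed R).

Definition loc_fun (M N : lmodType R) (f : {linear M -> N}) (z : loc S M) : loc S N :=
  frac (f (repr z).1) (repr z).2.

Lemma loc_funE (M N : lmodType R) (f : {linear M -> N}) x (s : mset S) :
  loc_fun f (frac x s) = frac (f x) s.
Proof.
have fZ c y : f (c *: y) = c *: f y by exact: linearZZ.
have /frac_eq[u e] := frac_repr (frac x s).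
by apply/frac_eq; exists u; move/(congr1 f): e; rewrite !fZ.
Qed.

Lemma loc_fun_linear (M N : lmodType R) (f : {linear M -> N}) : linear (loc_fun f).
Proof.
move=> a z w; case: (fracP z) (fracP w) => x [s ->] [y [t ->]].
rewrite [a *: _]locZE [frac _ _ + _]locDE !loc_funE [a *: _]locZE [RHS]locDE.
have fZ c v : f (c *: v) = c *: f v by exact: linearZZ.
by rewrite linearD !fZ.
Qed.

HB.instance Definition _ (M N : lmodType R) (f : {linear M -> N}) :=
  GRing.isLinear.Build R (loc S M) (loc S N) *:%R (loc_fun f) (loc_fun_linear f).

Definition loc_map (M N : lmodType R) (f : {linear M -> N}) :
  {linear loc S M -> loc S N} := loc_fun f.

Variable X : cplx R.

Lemma loc_diff_sq i z : loc_map (cdiff X i) (loc_map (cdiff X i.+1) z) = 0.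
Proof.
by case: (fracP z) => x [s ->]; rewrite /= !loc_funE cdiff_sq; apply/frac_eq0;
  exists (mset1 S); rewrite scaler0.
Qed.

Definition loc_cplx : cplx R := Cplx loc_diff_sq.

End LocalizedComplex.

(** The products [A_i x A_j -> A_(i+j)] and actions are total in the third
    degree and vanish off [k = i + j], which avoids transports along
    [(i + j) + k = i + (j + k)]. *)
Record dga (R : comPzRingType) := Dga {
  dga_cplx :> cplx R;
  dga_one : dga_cplx 0;
  dga_mul : forall i j k, dga_cplx i -> dga_cplx j -> dga_cplx k;
  dga_mul_shape : forall i j k (a : dga_cplx i) (b : dga_cplx j),
    (i + j)%N != k -> dga_mul k a b = 0;
  dga_mul_linl : forall i j k (b : dga_cplx j),
    linear (fun a : dga_cplx i => dga_mul k a b);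
  dga_mul_linr : forall i j k (a : dga_cplx i),
    linear (fun b : dga_cplx j => dga_mul k a b);
  dga_mul1l : forall i (a : dga_cplx i), dga_mul i dga_one a = a;
  dga_mul1r : forall i (a : dga_cplx i), dga_mul i a dga_one = a;
  dga_mulA : forall i j k (a : dga_cplx i) (b : dga_cplx j) (c : dga_cplx k),
    dga_mul (i + j + k) (dga_mul (i + j) a b) c =
    dga_mul (i + j + k) a (dga_mul (j + k) b c);
  dga_leibniz : forall i j k (a : dga_cplx i) (b : dga_cplx j), (i + j)%N = k.+1 ->
    cdiff dga_cplx k (dga_mul k.+1 a b) =
    dga_mul k (bdiff a) b + (-1) ^+ i *: dga_mul k a (bdiff b) }.

Record dga_map (R : comPzRingType) (A B : dga R) := DgaMap {
  dga_map_cmap :> cmap A B;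
  dga_map1 : dga_map_cmap 0 (dga_one A) = dga_one B;
  dga_mapM : forall i j k (a : A i) (b : A j), dga_map_cmap k (dga_mul k a b) =
    dga_mul k (dga_map_cmap i a) (dga_map_cmap j b) }.

Record dgmod (R : comPzRingType) (A : dga R) := Dgmod {
  dgm_cplx :> cplx R;
  dg_act : forall i j k, A i -> dgm_cplx j -> dgm_cplx k;
  act_shape : forall i j k (a : A i) (x : dgm_cplx j),
    (i + j)%N != k -> dg_act k a x = 0;
  act_linl : forall i j k (x : dgm_cplx j), linear (fun a : A i => dg_act k a x);
  act_linr : forall i j k (a : A i), linear (fun x : dgm_cplx j => dg_act k a x);
  act1 : forall i (x : dgm_cplx i), dg_act i (dga_one A) x = x;
  actA : forall i j k (a : A i) (b : A j) (x : dgm_cplx k),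
    dg_act (i + j + k) (dga_mul (i + j) a b) x = dg_act (i + j + k) a (dg_act (j + k) b x);
  act_leibniz : forall i j k (a : A i) (x : dgm_cplx j), (i + j)%N = k.+1 ->
    cdiff dgm_cplx k (dg_act k.+1 a x) =
    dg_act k (bdiff a) x + (-1) ^+ i *: dg_act k a (bdiff x) }.

Record dgmap (R : comPzRingType) (A : dga R) (X Y : dgmod A) := Dgmap {
  dgmap_cmap :> cmap X Y;
  dgmap_act : forall i j k (a : A i) (x : X j),
    dgmap_cmap k (dg_act k a x) = dg_act k a (dgmap_cmap j x) }.

Section DgModules.
Variables (R : comPzRingType) (A : dga R).

Definition dg_iso (X Y : dgmod A) : Prop :=
  exists (f : dgmap X Y) (g : dgmap Y X), forall i, cancel (f i) (g i) /\ cancel (g i) (f i).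

Definition dg_ses (X Y Z : dgmod A) : Prop :=
  exists (f : dgmap X Y) (g : dgmap Y Z), degreewise_exact f g.

End DgModules.

Section Restriction.
Variables (R : comPzRingType) (A B : dga R) (f : dga_map A B) (X : dgmod B).

Definition res_act i j k (a : A i) (x : X j) : X k := dg_act k (f i a) x.

Fact res_shape i j k (a : A i) (x : X j) : (i + j)%N != k -> res_act k a x = 0.
Proof. exact: act_shape. Qed.
Fact res_linl i j k (x : X j) : linear (fun a : A i => res_act k a x).
Proof. by move=> c a b; rewrite /res_act linearP act_linl. Qed.
Fact res_linr i j k (a : A i) : linear (fun x : X j => res_act k a x).
Proof. exact: act_linr. Qed.
Fact res_act1 i (x : X i) : res_act i (dga_one A) x = x.
Proof. by rewrite /res_act dga_map1 act1. Qed.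
Fact res_actA i j k (a : A i) (b : A j) (x : X k) :
  res_act (i + j + k) (dga_mul (i + j) a b) x =
  res_act (i + j + k) a (res_act (j + k) b x).
Proof. by rewrite /res_act dga_mapM actA. Qed.
Fact res_leibniz i j k (a : A i) (x : X j) : (i + j)%N = k.+1 ->
  cdiff X k (res_act k.+1 a x) =
  res_act k (bdiff a) x + (-1) ^+ i *: res_act k a (bdiff x).
Proof.
move=> e; rewrite /res_act act_leibniz //; congr (dg_act _ _ _ + _).
by case: i a {e} => [|i] a /=; rewrite ?linear0 // cmap_diff.
Qed.

Definition restrict : dgmod A :=
  Dgmod res_shape res_linl res_linr res_act1 res_actA res_leibniz.

End Restriction.

Section Koszul.
Variable R : comPzRingType.

(** The graded algebra [R[e]], [deg e = 1]: in degree [m] it is [R e^m],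
    identified with [R]. *)
Section Ts.
Variable s : R.

(** [d (e^(m+1))] is [s e^m] for [m] even and [0] for [m] odd. *)
Definition T_diff (m : nat) (a : R^o) : R^o := if odd m then 0 else s * a.
Fact T_diff_linear m : linear (T_diff m).
Proof.
move=> c a b; rewrite /T_diff; case: ifP => _; first by rewrite scaler0 addr0.
by rewrite mulrDr; congr (_ + _); exact: mulrCA.
Qed.
HB.instance Definition _ m :=
  GRing.isLinear.Build R R^o R^o *:%R (T_diff m) (T_diff_linear m).
Fact T_diff_sq m a : T_diff m (T_diff m.+1 a) = 0.
Proof. by rewrite /T_diff /=; case: (odd m); rewrite //= mulr0. Qed.

Definition T_cplx : cplx R :=
  @Cplx R (fun=> R^o) (fun m => T_diff m : {linear R^o -> R^o}) T_diff_sq.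

Definition T_mul (i j k : nat) (a b : R^o) : R^o := if (i + j == k)%N then a * b else 0.

Fact T_mul_shape i j k a b : (i + j)%N != k -> T_mul i j k a b = 0.
Proof. by rewrite /T_mul => /negbTE->. Qed.
Fact T_mul_linl i j k b : linear (fun a => T_mul i j k a b).
Proof.
move=> c x y; rewrite /T_mul; case: ifP => _; last by rewrite scaler0 addr0.
by rewrite mulrDl; congr (_ + _); rewrite -mulrA.
Qed.
Fact T_mulC i j k a b : T_mul i j k a b = T_mul j i k b a.
Proof. by rewrite /T_mul addnC mulrC. Qed.
Fact T_mul_linr i j k a : linear (T_mul i j k a).
Proof. by move=> c x y; rewrite ![T_mul i j k a _]T_mulC T_mul_linl. Qed.
Fact T_mul1l i a : T_mul 0 i i 1 a = a.
Proof. by rewrite /T_mul eqxx mul1r. Qed.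
Fact T_mul1r i a : T_mul i 0 i a 1 = a.
Proof. by rewrite T_mulC T_mul1l. Qed.
Fact T_mulA i j k a b c :
  T_mul (i + j) k (i + j + k) (T_mul i j (i + j) a b) c =
  T_mul i (j + k) (i + j + k) a (T_mul j k (j + k) b c).
Proof. by rewrite /T_mul addnA !eqxx mulrA. Qed.
Fact T_leibniz i j k (a b : R^o) : (i + j)%N = k.+1 ->
  T_diff k (T_mul i j k.+1 a b) =
  T_mul i.-1 j k (@bdiff _ T_cplx i a) b +
  (-1) ^+ i *: T_mul i j.-1 k a (@bdiff _ T_cplx j b).
Proof.
rewrite /T_mul /T_diff; case: i j => [|i] [|j] //=.
- rewrite add0n => -[->]; rewrite !eqxx mul0r if_same add0r expr0 scale1r.
  by rewrite /T_diff; case: odd; rewrite ?mulr0 // mulrCA.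
- rewrite !addn0 => -[->]; rewrite !eqxx mulr0 if_same scaler0 addr0 /T_diff.
  by case: odd; rewrite ?mul0r ?mulrA.
rewrite addSn => -[<-]; rewrite addSnnS !eqxx /T_diff oddD /= -signr_odd /=.
case: (odd i) (odd j) => [] [] /=;
  rewrite ?expr0 ?expr1 ?mul0r ?mulr0 ?add0r ?scaler0 ?addr0 ?scale1r ?scaleN1r.
- by [].
- by rewrite mulrCA.
- by rewrite mulrA.
- by rewrite [a * _]mulrCA mulrA subrr.
Qed.

Definition Ts : dga R :=
  @Dga R T_cplx (1 : R^o) T_mul T_mul_shape T_mul_linl T_mul_linr
    T_mul1l T_mul1r T_mulA T_leibniz.

End Ts.

(** The map [T_(s t) -> T_s], [e |-> t e], so [e^m |-> t^m e^m]. *)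
Section TsMap.
Variables s t : R.
Definition T_map_fun (m : nat) (a : R^o) : R^o := t ^+ m * a.
Fact T_map_linear m : linear (T_map_fun m).
Proof. by move=> c a b; rewrite /T_map_fun mulrDr; congr (_ + _); exact: mulrCA. Qed.
HB.instance Definition _ m :=
  GRing.isLinear.Build R R^o R^o *:%R (T_map_fun m) (T_map_linear m).
Fact T_map_diff m (a : R^o) :
  T_map_fun m (T_diff (s * t) m a) = T_diff s m (T_map_fun m.+1 a).
Proof.
by rewrite /T_map_fun /T_diff; case: odd; rewrite ?mulr0 // exprSr; ring.
Qed.
Definition T_cmap : cmap (Ts (s * t)) (Ts s) :=
  @Cmap R (Ts (s * t)) (Ts s) (fun m => T_map_fun m : {linear R^o -> R^o}) T_map_diff.
Fact T_map1 : T_map_fun 0 1 = 1.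
Proof. by rewrite /T_map_fun expr0 mul1r. Qed.
Fact T_mapM i j k (a b : R^o) :
  T_map_fun k (T_mul i j k a b) = T_mul i j k (T_map_fun i a) (T_map_fun j b).
Proof.
rewrite /T_map_fun /T_mul; case: eqP => [<-|_]; last by rewrite mulr0.
by rewrite exprD; ring.
Qed.
Definition T_map : dga_map (Ts (s * t)) (Ts s) :=
  @DgaMap R (Ts (s * t)) (Ts s) T_cmap T_map1 T_mapM.
End TsMap.

End Koszul.

Section Subgroup.
Variables (V : zmodType) (rel : V -> Prop).

Definition subgroup_gen : {pred V} :=
  fun x => `[< forall H : zmodClosed V, (forall y, rel y -> y \in H) -> x \in H >].

Fact subgroup_gen_closed : zmod_closed subgroup_gen.
Proof.
split=> [|x y /asboolP hx /asboolP hy]; apply/asboolP => H hH; first exact: rpred0.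
by rewrite rpredB ?hx ?hy.
Qed.
HB.instance Definition _ := GRing.isZmodClosed.Build V subgroup_gen subgroup_gen_closed.

Definition ab_quot : zmodType := Quotient.quot (subgroup_gen : zmodClosed V).
Definition ab_proj (x : V) : ab_quot := \pi_(Quotient.quot (subgroup_gen : zmodClosed V)) x.

Fact ab_proj_additive : zmod_morphism ab_proj.
Proof. by move=> x y; rewrite /ab_proj !raddfB. Qed.
HB.instance Definition _ := GRing.isZmodMorphism.Build V ab_quot ab_proj ab_proj_additive.

Lemma ab_projK (z : ab_quot) : ab_proj (repr z) = z. Proof. exact: reprK. Qed.

Lemma ab_proj_surj z : exists x, ab_proj x = z.
Proof. by exists (repr z); exact: ab_projK. Qed.

Lemma ab_proj_eq0 x : ab_proj x = 0 <-> x \in subgroup_gen.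
Proof.
rewrite -[in X in _ <-> X](subr0 x) (Quotient.idealrBE (subgroup_gen : zmodClosed V)).
rewrite -(raddf0 ab_proj); by split=> /eqP.
Qed.

Lemma ab_proj_rel x : rel x -> ab_proj x = 0.
Proof. by move=> rx; apply/ab_proj_eq0/asboolP => H; apply. Qed.

Section Lift.
Variables (W : zmodType) (f : {additive V -> W}).
Hypothesis frel : forall x, rel x -> f x = 0.

Definition ab_lift_fun (z : ab_quot) : W := f (repr z).

Definition ab_ker : {pred V} := fun x => f x == 0.
Fact ab_ker_closed : zmod_closed ab_ker.
Proof.
split=> [|x y]; first by rewrite /in_mem /= /ab_ker raddf0.
by rewrite /in_mem /= /ab_ker => /eqP fx /eqP fy; rewrite raddfB fx fy subr0.
Qed.
HB.instance Definition _ := GRing.isZmodClosed.Build V ab_ker ab_ker_closed.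

Lemma ab_lift_funE x : ab_lift_fun (ab_proj x) = f x.
Proof.
apply/subr0_eq; rewrite -raddfB.
have /asboolP/(_ ab_ker) : repr (ab_proj x) - x \in subgroup_gen.
  by apply/ab_proj_eq0; rewrite raddfB; apply/eqP; rewrite subr_eq0; apply/eqP; exact: ab_projK.
by move=> h; apply/eqP/h => y /frel /eqP.
Qed.

Fact ab_lift_additive : zmod_morphism ab_lift_fun.
Proof.
move=> z w; case: (ab_proj_surj z) (ab_proj_surj w) => x <- [y <-].
by rewrite -raddfB !ab_lift_funE raddfB.
Qed.
HB.instance Definition _ :=
  GRing.isZmodMorphism.Build ab_quot W ab_lift_fun ab_lift_additive.

Definition ab_lift : {additive ab_quot -> W} := ab_lift_fun.

Lemma ab_liftE x : ab_lift (ab_proj x) = f x. Proof. exact: ab_lift_funE. Qed.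

End Lift.
End Subgroup.

Section FreeAb.
Variable T : Type.

Definition freeab : zmodType := {freeg {classic T} / int}.
Definition fgen (t : T) : freeab := << (t : {classic T}) >>.

Section Lift.
Variables (W : zmodType) (f : T -> W).
Definition freeab_lift_fun (x : freeab) : W :=
  fglift (f : {classic T} -> zmodule W) x.
Fact freeab_lift_additive : zmod_morphism freeab_lift_fun.
Proof. exact: (@lift_is_additive int {classic T} (zmodule W) f). Qed.
HB.instance Definition _ :=
  GRing.isZmodMorphism.Build freeab W freeab_lift_fun freeab_lift_additive.
Definition freeab_lift : {additive freeab -> W} := freeab_lift_fun.

Lemma freeab_liftE t : freeab_lift (fgen t) = f t.
Proof. by rewrite /= /freeab_lift_fun liftU; exact: (@scale1r int (zmodule W)). Qed.
End Lift.

Lemma freeab_ext (W : zmodType) (u v : {additive freeab -> W}) :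
  (forall t, u (fgen t) = v (fgen t)) -> u =1 v.
Proof.
move=> uv x; rewrite -(freeg_sumE x) !raddf_sum; apply: eq_bigr => t _.
have -> : << coeff t x *g t >> = fgen t *~ coeff t x :> freeab.
  by have := @freegU_mulz int {classic T} (coeff t x) t; rewrite intz => <-.
by rewrite !raddfMz uv.
Qed.

End FreeAb.

(** [cls] stands for a complete isomorphism invariant, and the isomorphism
    classes are represented by its values. *)
Section Grothendieck.
Variables (Obj C : Type) (cls : Obj -> C -> Prop).
Variables (ses : Obj -> Obj -> Obj -> Prop) (acyc : Obj -> Prop).

Definition iso_class : Type := {A : C -> Prop | exists X, A = cls X}.
Definition class_of (X : Obj) : iso_class := exist _ (cls X) (ex_intro _ X erefl).

Definition groth_rel (r : freeab iso_class) : Prop :=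
  (exists X' X X'', ses X' X X'' /\
     r = fgen (class_of X) - (fgen (class_of X') + fgen (class_of X''))) \/
  (exists2 X, acyc X & r = fgen (class_of X)).

Definition groth : zmodType := ab_quot groth_rel.
Definition groth_class (X : Obj) : groth := ab_proj groth_rel (fgen (class_of X)).

Lemma class_of_eq X Y : cls X = cls Y -> class_of X = class_of Y.
Proof.
move=> e; rewrite /class_of; move: (ex_intro _ X _) (ex_intro _ Y _).
by rewrite e => p q; congr exist; exact: Prop_irrelevance.
Qed.

Lemma groth_class_eq X Y : cls X = cls Y -> groth_class X = groth_class Y.
Proof. by move=> e; congr (ab_proj _ (fgen _)); exact: class_of_eq. Qed.

Lemma groth_class_ses X' X X'' : ses X' X X'' ->
  groth_class X = groth_class X' + groth_class X''.
Proof.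
move=> h; apply/subr0_eq; rewrite /groth_class -raddfD -raddfB.
by apply: ab_proj_rel; left; exists X', X, X''.
Qed.

Lemma groth_class_acyc X : acyc X -> groth_class X = 0.
Proof. by move=> h; apply: ab_proj_rel; right; exists X. Qed.

Lemma groth_ext (W : zmodType) (u v : {additive groth -> W}) :
  (forall X, u (groth_class X) = v (groth_class X)) -> u =1 v.
Proof.
move=> uv z; have [x <-] := ab_proj_surj z.
apply: (@freeab_ext _ W (u \o ab_proj groth_rel) (v \o ab_proj groth_rel)) => A /=.
suff [X ->] : exists X, A = class_of X by exact: uv.
by case: A => A [X e]; exists X; subst A.
Qed.

Section Lift.
Variables (W : zmodType) (F : Obj -> W).
Hypothesis F_iso : forall X Y, cls X = cls Y -> F X = F Y.
Hypothesis F_ses : forall X' X X'', ses X' X X'' -> F X = F X' + F X''.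
Hypothesis F_acyc : forall X, acyc X -> F X = 0.

Definition iso_class_repr (A : iso_class) : Obj := sval (cid (svalP A)).

Lemma iso_class_reprK X : F (iso_class_repr (class_of X)) = F X.
Proof. by apply: F_iso; rewrite /iso_class_repr; case: cid => Y /= ->. Qed.

Definition groth_lift_free : {additive freeab iso_class -> W} :=
  freeab_lift (fun A => F (iso_class_repr A)).

Fact groth_lift_rel r : groth_rel r -> groth_lift_free r = 0.
Proof.
rewrite /groth_lift_free; case=> [[X' [X [X'' [h ->]]]]|[X h ->]].
  rewrite raddfB raddfD !freeab_liftE !iso_class_reprK (F_ses h).
  by rewrite subrr.
by rewrite freeab_liftE iso_class_reprK F_acyc.
Qed.

Definition groth_lift : {additive groth -> W} := ab_lift groth_lift_rel.

Lemma groth_liftE X : groth_lift (groth_class X) = F X.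
Proof.
by rewrite /groth_lift ab_liftE /groth_lift_free freeab_liftE iso_class_reprK.
Qed.
End Lift.
End Grothendieck.

(** Sets of complexes of [lmodType]s live in too large a universe to index
    the generators of a [zmodType]. A graded module with operators
    [op o : M (src o) -> M (tgt o)] and finitely generated components is
    instead classified by the set of its presentations by generators, which
    lives in a small type; [presentationsP] shows that this is a complete
    isomorphism invariant. *)
Section Presentations.
Variables (R : comPzRingType) (O : Type) (src tgt : O -> nat).

Record presentation := Presentation {
  gens : nat -> nat;
  relns : forall i, ('I_(gens i) -> R) -> Prop;
  opgraph : forall o, ('I_(gens (src o)) -> R) -> ('I_(gens (tgt o)) -> R) -> Prop }.

Definition presentations (M : nat -> lmodType R) (op : forall o, M (src o) -> M (tgt o))
    (c : presentation) : Prop :=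
  exists g : forall i, 'I_(gens c i) -> M i,
    [/\ forall i, generates (g i),
        forall i v, @relns c i v <-> comb (g i) v = 0
      & forall o v w, @opgraph c o v w <-> op o (comb (g (src o)) v) = comb (g (tgt o)) w].

Variables (M N : nat -> lmodType R).
Variables (opM : forall o, M (src o) -> M (tgt o)) (opN : forall o, N (src o) -> N (tgt o)).

Lemma presentationsP : (forall i, fin_gen (M i)) ->
  presentations opM = presentations opN <->
  exists f : forall i, {linear M i -> N i},
    (forall i, bijective (f i)) /\
    (forall o x, f (tgt o) (@opM o x) = @opN o (f (src o) x)).
Proof.
move=> fgM; split=> [eqMN|[f [bij_f f_op]]]; last first.
  have inj_f i : injective (f i) by exact: bij_inj.
  apply/funext => c; apply/propext; split=> -[g [gen_g rel_g op_g]].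
    exists (fun i j => f i (g i j)).
    have fg i v : comb (fun j => f i (g i j)) v = f i (comb (g i) v).
      by rewrite comb_lin.
    split=> [i y|i v|o v w].
    - have [k _ fK] := bij_f i; have [v gv] := gen_g i (k y).
      by exists v; rewrite fg gv fK.
    - rewrite fg rel_g; split=> [->|]; first exact: linear0.
      by rewrite -(linear0 (f i)) => /inj_f.
    - by rewrite op_g !fg -f_op; split=> [->|/inj_f].
  have inv_f i : exists2 h, cancel (f i) h & cancel h (f i).
    by have [k fK kK] := bij_f i; exists k.
  pose h i := s2val (cid2 (inv_f i)).
  have hK i : cancel (h i) (f i) := s2valP' (cid2 (inv_f i)).
  exists (fun i j => h i (g i j)).
  have fg i v : f i (comb (fun j => h i (g i j)) v) = comb (g i) v.
    rewrite comb_lin; congr comb; apply/funext => j.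
    exact: hK.
  split=> [i y|i v|o v w].
  - by have [v gv] := gen_g i (f i y); exists v; apply: inj_f; rewrite fg.
  - rewrite rel_g -fg; split=> [|->]; last exact: linear0.
    by rewrite -(linear0 (f i)) => /inj_f.
  - by rewrite op_g -!fg -f_op; split=> [/inj_f|->].
pose n i := sval (cid (fgM i)).
pose g i : 'I_(n i) -> M i := sval (cid (svalP (cid (fgM i)))).
have gen_g i : generates (g i) := svalP (cid (svalP (cid (fgM i)))).
pose c := @Presentation n (fun i v => comb (g i) v = 0)
  (fun o v w => opM (comb (g (src o)) v) = comb (g (tgt o)) w).
have : presentations opM c by exists g.
rewrite eqMN => -[g' [gen_g' /= rel_g' op_g']].
pose f i x := comb (g' i) (sval (cid (gen_g i x))).
pose h i y := comb (g i) (sval (cid (gen_g' i y))).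
have fE i v : f i (comb (g i) v) = comb (g' i) v.
  rewrite /f; case: cid => w /= gw; apply/subr0_eq.
  by rewrite -combB; apply/rel_g'; rewrite combB gw subrr.
have hE i v : h i (comb (g' i) v) = comb (g i) v.
  rewrite /h; case: cid => w /= gw; apply/subr0_eq.
  by rewrite -combB; apply/rel_g'; rewrite combB gw subrr.
have f_lin i : linear (f i).
  move=> a x y; case: (gen_g i x) (gen_g i y) => v <- [w <-].
  by rewrite -combP !fE combP.
pose F i : {linear M i -> N i} :=
  HB.pack (f i) (GRing.isLinear.Build R (M i) (N i) *:%R (f i) (f_lin i)).
exists F; split=> [i|o x].
  exists (h i) => [x|y]; first by case: (gen_g i x) => v <-; rewrite /= fE hE.
  by case: (gen_g' i y) => v <-; rewrite hE /= fE.
have [v <-] := gen_g _ x; have [w hw] := gen_g _ (opM (comb (g (src o)) v)).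
by rewrite -hw /= !fE; apply/esym/op_g'.
Qed.

End Presentations.

Section Classes.
Variable R : comPzRingType.

Definition cplx_class (X : cplx R) : presentation R succn id -> Prop :=
  @presentations R nat succn id X (cdiff X).

Lemma lin_inv (M N : lmodType R) (f : {linear M -> N}) :
  bijective f -> {g : {linear N -> M} | cancel f g & cancel g f}.
Proof.
move=> bij_f.
have /cid2[g fK gK] : exists2 g, cancel f g & cancel g f.
  by have [g fK gK] := bij_f; exists g.
have g_lin : linear g.
  move=> a x y; apply: (can_inj fK).
  by rewrite gK linearP !gK.
by exists (HB.pack_for {linear N -> M} g (GRing.isLinear.Build R N M *:%R g g_lin)).
Qed.

Lemma cplx_classP (X Y : cplx R) : (forall i, fin_gen (X i)) ->
  cplx_class X = cplx_class Y <-> cplx_iso X Y.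
Proof.
move=> fgX; rewrite (presentationsP _ _ fgX); split=> [[f [bij_f f_d]]|[f [g fgK]]].
  pose g i := s2val (lin_inv (bij_f i)).
  have fK i : cancel (f i) (g i) := s2valP (lin_inv (bij_f i)).
  have gK i : cancel (g i) (f i) := s2valP' (lin_inv (bij_f i)).
  have g_d i y : g i (cdiff Y i y) = cdiff X i (g i.+1 y).
    by apply: (can_inj (fK i)); rewrite gK f_d gK.
  by exists (Cmap f_d), (Cmap g_d) => i; split; [exact: fK | exact: gK].
exists f; split=> [i|o x]; last exact: cmap_diff.
by have [fK gK] := fgK i; exists (g i).
Qed.

Variable A : dga R.

Variant dg_op := OpDiff of nat | OpAct i (j k : nat) of A i.
Definition dg_src (o : dg_op) := match o with OpDiff m => m.+1 | OpAct _ j _ _ => j end.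
Definition dg_tgt (o : dg_op) := match o with OpDiff m => m | OpAct _ _ k _ => k end.
Definition dg_opfun (X : dgmod A) (o : dg_op) : X (dg_src o) -> X (dg_tgt o) :=
  match o with OpDiff m => cdiff X m | OpAct i j k a => dg_act k a end.

Definition dg_class (X : dgmod A) : presentation R dg_src dg_tgt -> Prop :=
  presentations (@dg_opfun X).

Lemma dg_classP (X Y : dgmod A) : (forall i, fin_gen (X i)) ->
  dg_class X = dg_class Y <-> dg_iso X Y.
Proof.
move=> fgX; rewrite (presentationsP _ _ fgX); split=> [[f [bij_f f_op]]|[f [g fgK]]].
  pose g i := s2val (lin_inv (bij_f i)).
  have fK i : cancel (f i) (g i) := s2valP (lin_inv (bij_f i)).
  have gK i : cancel (g i) (f i) := s2valP' (lin_inv (bij_f i)).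
  have f_d i := f_op (OpDiff i).
  have f_a i j k (a : A i) := f_op (OpAct j k a).
  have g_d i y : g i (cdiff Y i y) = cdiff X i (g i.+1 y).
    by apply: (can_inj (fK i)); rewrite gK [f _ _]f_d gK.
  have g_a i j k (a : A i) (y : Y j) : g k (dg_act k a y) = dg_act k a (g j y).
    by apply: (can_inj (fK k)); rewrite gK [f _ _]f_a gK.
  exists (@Dgmap _ _ X Y (Cmap f_d) f_a), (@Dgmap _ _ Y X (Cmap g_d) g_a) => i.
  by split; [exact: fK | exact: gK].
exists f; split=> [i|[m|i j k a] x].
- by have [fK gK] := fgK i; exists (g i).
- exact: cmap_diff.
- exact: dgmap_act.
Qed.

End Classes.

Section Groups.
Variable R : comPzRingType.

Definition perf_on (S : mulrClosed R) (n : option nat) : Type :=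
  {X : cplx R | in_P n X /\ acyclic (loc_cplx S X)}.

Definition G_on (S : mulrClosed R) (n : option nat) : zmodType :=
  groth (fun X : perf_on S n => cplx_class (sval X))
        (fun X Y Z => cplx_ses (sval X) (sval Y) (sval Z))
        (fun X => acyclic (sval X)).

Definition G_on_class (S : mulrClosed R) n (X : perf_on S n) : G_on S n :=
  groth_class _ _ _ X.

Definition perf_dg (A : dga R) (n : option nat) : Type := {X : dgmod A | in_P n X}.

Definition G_dg (A : dga R) (n : option nat) : zmodType :=
  groth (fun X : perf_dg A n => dg_class (sval X))
        (fun X Y Z => dg_ses (sval X) (sval Y) (sval Z))
        (fun X => acyclic (sval X)).

Definition G_dg_class (A : dga R) n (X : perf_dg A n) : G_dg A n :=
  groth_class _ _ _ X.

Lemma perf_on_class_ofP (S : mulrClosed R) n (X Y : perf_on S n) :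
  let cls (X : perf_on S n) := cplx_class (sval X) in
  class_of cls X = class_of cls Y <-> cplx_iso (sval X) (sval Y).
Proof.
move=> cls; rewrite -cplx_classP; last by have [[h _ _] _] := svalP X => i; have [] := h i.
by split=> [/(congr1 sval)|/(@class_of_eq _ _ cls)].
Qed.

Lemma perf_dg_class_ofP (A : dga R) n (X Y : perf_dg A n) :
  let cls (X : perf_dg A n) := dg_class (sval X) in
  class_of cls X = class_of cls Y <-> dg_iso (sval X) (sval Y).
Proof.
move=> cls; rewrite -dg_classP; last by have [h _ _] := svalP X => i; have [] := h i.
by split=> [/(congr1 sval)|/(@class_of_eq _ _ cls)].
Qed.

Lemma in_P_fg n (X : cplx R) : in_P n X -> forall i, fin_gen (X i).
Proof. by case=> h _ _ i; have [] := h i. Qed.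

Section Restrict.
Variables (A B : dga R) (f : dga_map A B) (n : option nat).

Definition restrict_map (X Y : dgmod B) (u : dgmap X Y) :
  dgmap (restrict f X) (restrict f Y) :=
  @Dgmap R A (restrict f X) (restrict f Y) u
    (fun i j k a x => dgmap_act u k (f i a) x).

Definition restrict_perf (X : perf_dg B n) : perf_dg A n :=
  exist _ (restrict f (sval X)) (svalP X).

Fact restrict_iso (X Y : perf_dg B n) : dg_class (sval X) = dg_class (sval Y) ->
  G_dg_class (restrict_perf X) = G_dg_class (restrict_perf Y).
Proof.
move=> /(dg_classP _ (in_P_fg (svalP X)))[u [v uv]]; apply: groth_class_eq.
apply/(@dg_classP _ _ (restrict f (sval X))); first exact: in_P_fg (svalP X).
by exists (restrict_map u), (restrict_map v).
Qed.

Fact restrict_ses (X Y Z : perf_dg B n) : dg_ses (sval X) (sval Y) (sval Z) ->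
  G_dg_class (restrict_perf Y) =
  G_dg_class (restrict_perf X) + G_dg_class (restrict_perf Z).
Proof.
by move=> [u [v uv]]; apply: groth_class_ses; exists (restrict_map u), (restrict_map v).
Qed.

Fact restrict_acyclic (X : perf_dg B n) : acyclic (sval X) ->
  G_dg_class (restrict_perf X) = 0.
Proof. by move=> aX; apply: groth_class_acyc. Qed.

Definition G_restrict : {additive G_dg B n -> G_dg A n} :=
  groth_lift restrict_iso restrict_ses restrict_acyclic.

Lemma G_restrictE X : G_restrict (G_dg_class X) = G_dg_class (restrict_perf X).
Proof. exact: groth_liftE. Qed.

End Restrict.

Section Forget.
Variables (S : mulrClosed R) (s : mset S) (n : option nat).

Lemma linear_zero (M N : lmodType R) (h : M -> N) : linear h -> h 0 = 0.
Proof.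
move=> /(_ 1 0 0); rewrite scaler0 addr0 scale1r => e.
by apply: (addrI (h 0)); rewrite -e addr0.
Qed.

Lemma linear_scale (M N : lmodType R) (h : M -> N) : linear h ->
  forall c a, h (c *: a) = c *: h a.
Proof.
move=> h_lin c a; have h0 := linear_zero h_lin.
by rewrite -[c *: a]addr0 h_lin h0 addr0.
Qed.

Lemma act0r (A : dga R) (X : dgmod A) i j k (a : A i) : dg_act k a (0 : X j) = 0.
Proof. exact: (linear_zero (@act_linr _ _ X i j k a)). Qed.

Lemma actZr (A : dga R) (X : dgmod A) i j k (a : A i) c (x : X j) :
  dg_act k a (c *: x) = c *: dg_act k a x.
Proof. exact: (linear_scale (@act_linr _ _ X i j k a)). Qed.

Lemma Ts_homotopy (r : R) (X : dgmod (Ts r)) k (x : X k) :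
  cdiff X k (dg_act k.+1 (1 : Ts r 1%N) x) = r *: x - dg_act k (1 : Ts r 1%N) (bdiff x).
Proof.
rewrite act_leibniz // expr1 scaleN1r; congr (_ - _).
have -> : bdiff (1 : Ts r 1%N) = r *: dga_one (Ts r) :> Ts r 0%N by [].
by rewrite (linear_scale (@act_linl _ _ X 0 k k x)) act1.
Qed.

Lemma Ts_loc_acyclic (X : dgmod (Ts (sval s))) : acyclic (loc_cplx S X).
Proof.
split=> [z|i z].
  have [x [t ->]] := fracP z.
  exists (frac (dg_act 1 (1 : Ts (sval s) 1%N) x) (msetM s t)).
  rewrite [LHS]loc_funE Ts_homotopy /= act0r subr0.
  by apply/frac_eq; exists (mset1 S); rewrite /= !scalerA; congr (_ *: _); ring.
have [x [t ->]] := fracP z => /=; rewrite loc_funE => /frac_eq0[u hu].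
exists (frac (sval u *: dg_act i.+2 (1 : Ts (sval s) 1%N) x) (msetM u (msetM s t))).
rewrite [LHS]loc_funE linearZ /= Ts_homotopy /= scalerBr.
rewrite -actZr hu act0r subr0.
apply/frac_eq; exists (mset1 S); rewrite /= !scalerA; congr (_ *: _); ring.
Qed.

Definition forget_perf (X : perf_dg (Ts (sval s)) n) : perf_on S n :=
  exist _ (dgm_cplx (sval X)) (conj (svalP X) (Ts_loc_acyclic (sval X))).

Fact forget_iso X Y : dg_class (sval X) = dg_class (sval Y) ->
  G_on_class (forget_perf X) = G_on_class (forget_perf Y).
Proof.
move=> /(dg_classP _ (in_P_fg (svalP X)))[u [v uv]]; apply: groth_class_eq.
by apply/(cplx_classP _ (in_P_fg (svalP X))); exists u, v.
Qed.

Fact forget_ses X Y Z : dg_ses (sval X) (sval Y) (sval Z) ->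
  G_on_class (forget_perf Y) = G_on_class (forget_perf X) + G_on_class (forget_perf Z).
Proof. by move=> [u [v uv]]; apply: groth_class_ses; exists u, v. Qed.

Fact forget_acyclic (X : perf_dg (Ts (sval s)) n) : acyclic (sval X) ->
  G_on_class (forget_perf X) = 0.
Proof. by move=> aX; apply: groth_class_acyc. Qed.

Definition G_forget : {additive G_dg (Ts (sval s)) n -> G_on S n} :=
  groth_lift forget_iso forget_ses forget_acyclic.

Lemma G_forgetE X : G_forget (G_dg_class X) = G_on_class (forget_perf X).
Proof. exact: groth_liftE. Qed.

End Forget.
End Groups.

Section Colimit.
Variables (R : comPzRingType) (S : mulrClosed R).

(** A morphism of [tS] out of [s] is an [x] in [S], and its target is [s x];
    [tr s x] is the map induced by it. *)
Variables (F : mset S -> zmodType) (tr : forall s x : mset S, {additive F s -> F (msetM s x)}).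

Definition colim_gen (s : mset S) (a : F s) : freeab {s : mset S & F s} :=
  fgen (existT F s a).

Definition colim_rel (r : freeab {s : mset S & F s}) : Prop :=
  (exists s (a b : F s), r = colim_gen (a + b) - (colim_gen a + colim_gen b)) \/
  (exists s x (a : F s), r = colim_gen a - colim_gen (tr s x a)).

Definition colim : zmodType := ab_quot colim_rel.

Definition colim_in_fun s (a : F s) : colim := ab_proj colim_rel (colim_gen a).

Fact colim_in_additive s : zmod_morphism (@colim_in_fun s).
Proof.
have D (a b : F s) : colim_in_fun (a + b) = colim_in_fun a + colim_in_fun b.
  apply/subr0_eq; rewrite /colim_in_fun -raddfD -raddfB.
  by apply: ab_proj_rel; left; exists s, a, b.
by move=> a b; apply/(addIr (colim_in_fun b)); rewrite -D !subrK.
Qed.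
HB.instance Definition _ s :=
  GRing.isZmodMorphism.Build (F s) colim (@colim_in_fun s) (@colim_in_additive s).
Definition colim_in s : {additive F s -> colim} := @colim_in_fun s.

Lemma colim_in_tr s x (a : F s) : colim_in _ (tr s x a) = colim_in s a.
Proof.
apply/esym/subr0_eq; rewrite /= /colim_in_fun -raddfB.
by apply: ab_proj_rel; right; exists s, x, a.
Qed.

Section Lift.
Variables (W : zmodType) (f : forall s, {additive F s -> W}).
Hypothesis f_tr : forall s x (a : F s), f (msetM s x) (tr s x a) = f s a.

Definition colim_lift_free : {additive freeab {s : mset S & F s} -> W} :=
  freeab_lift (fun p => f (projT1 p) (projT2 p)).

Fact colim_lift_rel r : colim_rel r -> colim_lift_free r = 0.
Proof.
rewrite /colim_lift_free /colim_gen.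
case=> [[s [a [b ->]]]|[s [x [a ->]]]]; rewrite raddfB ?raddfD !freeab_liftE /=.
  by rewrite raddfD -opprD subrr.
by rewrite f_tr subrr.
Qed.

Definition colim_lift : {additive colim -> W} := ab_lift colim_lift_rel.

Lemma colim_liftE s (a : F s) : colim_lift (colim_in s a) = f s a.
Proof.
by rewrite /colim_lift ab_liftE /colim_lift_free /colim_gen freeab_liftE.
Qed.
End Lift.
End Colimit.

Section Comparison.
Variables (R : comPzRingType) (S : mulrClosed R) (n : option nat).

Definition G_T (s : mset S) : zmodType := G_dg (Ts (sval s)) n.

Definition G_T_tr (s x : mset S) : {additive G_T s -> G_T (msetM s x)} :=
  G_restrict (T_map (sval s) (sval x)) n.

Definition colim_G_T : zmodType := colim G_T_tr.

Fact G_forget_tr s x (a : G_T s) :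
  G_forget (msetM s x) n (G_T_tr s x a) = G_forget s n a.
Proof.
apply: (@groth_ext _ _ _ _ _ _ (G_forget (msetM s x) n \o G_T_tr s x) (G_forget s n)).
move=> X.
have e : G_T_tr s x (G_dg_class X) =
    G_dg_class (restrict_perf (T_map (sval s) (sval x)) X) := G_restrictE _ _.
have -> : G_forget s n (G_dg_class X) = G_on_class (forget_perf X) := G_forgetE _.
change (G_forget (msetM s x) n (G_T_tr s x (G_dg_class X)) = G_on_class (forget_perf X)).
rewrite e; etransitivity; first exact: G_forgetE.
exact: groth_class_eq.
Qed.

Definition G_comparison : {additive colim_G_T -> G_on S n} :=
  colim_lift G_forget_tr.

Lemma G_comparisonE s (X : perf_dg (Ts (sval s)) n) :
  G_comparison (colim_in G_T_tr s (G_dg_class X)) = G_on_class (forget_perf X).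
Proof. by rewrite /G_comparison colim_liftE G_forgetE. Qed.

End Comparison.

(* Main.v *)
(** A [T_s]-module is a complex with a null-homotopy [e] of [s], and a perfect
    complex with [S]-torsion homology has one for some [s] in [S]. So the inverse
    map sends [[X]] to [[X, e]] in the colimit, and two points need an argument.

    Additivity: null-homotopies of the ends of a short exact sequence extend to
    its middle term once [s] is replaced by [s^2].

    Independence of [e]: let [K] be [X_0 --s--> X_0] in degrees 1 and 0. The
    identity of [X_0] extends by [e] to a map [K -> X], and [X] is a degreewise
    split quotient of [W = Y (+) K], where [Y] is an acyclic sum of disks on the
    [X_i] with [i >= 1], all without exceeding the bound [n >= 1]. If [Z] is the
    kernel with some fixed null-homotopy, then [[X, e'] = [W, e_W] - [Z]] for
    every [e'] and some [e_W] depending on [e'].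
    But [[W, e_W] = [K]] for every [e_W]: after multiplication by [s], the
    subcomplex [Y] is stable under [e_W], and the induced null-homotopy of [K] is
    the standard one up to a scalar. *)

From HB Require Import structures.
From mathcomp Require Import all_boot all_order all_algebra.
From mathcomp Require Import ring boolp.
Require Import Defs.

Set Implicit Arguments.
Unset Strict Implicit.
Unset Printing Implicit Defensive.
Import GRing.Theory.
Local Open Scope ring_scope.

(** * Null-homotopies of multiplication by a scalar *)

Section NullHomotopy.
Variables (R : comPzRingType) (X : cplx R).
Implicit Type e : forall i, {linear X i -> X i.+1}.

(** The term [e d] of the homotopy formula, zero in degree 0, where no differential leaves. *)
Definition nh_prev e i : {linear X i -> X i} :=
  match i with 0 => \0 | k.+1 => e k \o cdiff X k end.

Definition htpy e i : {linear X i -> X i} := (cdiff X i \o e i) \+ nh_prev e i.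

Lemma nh_prev_diff e i x : nh_prev e i (cdiff X i x) = 0.
Proof. by case: i x => [|i] x //=; rewrite cdiff_sq linear0. Qed.

Lemma htpy_diff e i x : cdiff X i (htpy e i.+1 x) = htpy e i (cdiff X i x).
Proof. by rewrite /= linearD cdiff_sq add0r nh_prev_diff addr0. Qed.

Record null_homotopy (r : R) := NullHomotopy {
  nh_fun :> forall i, {linear X i -> X i.+1};
  nhP : forall i x, htpy nh_fun i x = r *: x }.

Lemma nh_diff0 r (e : null_homotopy r) x : cdiff X 0 (e 0 x) = r *: x.
Proof. by rewrite -(nhP e) /= addr0. Qed.

Lemma nh_diffS r (e : null_homotopy r) i x :
  cdiff X i.+1 (e i.+1 x) = r *: x - e i (cdiff X i x).
Proof. by rewrite -(nhP e) /= addrK. Qed.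

End NullHomotopy.

Lemma htpy_nat (R : comPzRingType) (X Y : cplx R) (u : cmap X Y)
    (e : forall i, {linear X i -> X i.+1}) (e' : forall i, {linear Y i -> Y i.+1}) :
    (forall i x, u i.+1 (e i x) = e' i (u i x)) ->
  forall i x, u i (htpy e i x) = htpy e' i (u i x).
Proof.
move=> ue [|i] x; rewrite /= linearD cmap_diff ue ?linear0 //.
by rewrite ue cmap_diff.
Qed.

(** * [T_r]-modules as complexes with a null-homotopy of [r] *)

Section KoszulAction.
Variables (R : comPzRingType) (X : cplx R) (r : R) (e : null_homotopy X r).

(** The default 0 off [j = k] makes this total, so the iterates of [e] can be typed in any target
    degree without carrying an equation. *)
Definition deg_cast j k (x : X j) : X k :=
  if j =P k is ReflectT jk then ecast k (X k) jk x else 0.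

Lemma deg_cast_id j (x : X j) : deg_cast j x = x.
Proof. by rewrite /deg_cast; case: eqP => // jj; rewrite eq_axiomK. Qed.

Lemma deg_cast_linear j k : linear (@deg_cast j k).
Proof.
move=> a x y; rewrite /deg_cast; case: eqP => [jk|_]; last by rewrite scaler0 addr0.
by case: k / jk.
Qed.

(** The action of [e^i], total in the target degree, like [dg_act]. *)
Fixpoint nh_iter i j k (x : X j) {struct i} : X k :=
  match i, k with
  | 0, _ => deg_cast k x
  | i.+1, 0 => 0
  | i.+1, k.+1 => e k (nh_iter i k x)
  end.

Lemma nh_iter_linear i j k : linear (@nh_iter i j k).
Proof.
elim: i j k => [|i IH] j k a x y; first exact: deg_cast_linear.
by case: k => [|k] /=; [rewrite scaler0 addr0 | rewrite IH linearP].
Qed.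

Lemma nh_iter_shape i j k (x : X j) : (i + j)%N != k -> nh_iter i k x = 0.
Proof.
elim: i j k x => [|i IH] j k x /=.
  by rewrite add0n /deg_cast; case: eqP.
by case: k => // k; rewrite addSn eqSS => /IH ->; rewrite linear0.
Qed.

Lemma nh_iterA i j l (x : X l) :
  nh_iter (i + j) (i + j + l) x = nh_iter i (i + j + l) (nh_iter j (j + l) x).
Proof.
elim: i => [|i IH]; first by rewrite /= deg_cast_id.
by rewrite !addSn /= IH.
Qed.

(** Moving [d] past each [e] leaves a term [r e^(i-1)], with alternating signs; the sum is
    [r e^(i-1)] for odd [i] and 0 for even [i]. *)
Lemma nh_iter_diff i j k (x : X j) : (i + j)%N = k.+1 ->
  cdiff X k (nh_iter i k.+1 x) =
  (r *+ odd i) *: nh_iter i.-1 k x + (-1) ^+ i *: nh_iter i k (bdiff x).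
Proof.
elim: i j k x => [|i IH] j k x /=.
  move=> jk; have {jk} jk : j = k.+1 by exact: jk.
  subst j; rewrite !deg_cast_id /= scale0r add0r expr0.
  by rewrite scale1r.
rewrite addSn => -[] ijk; case: k ijk => [|k] ijk.
  have [-> j0] : i = 0 /\ j = 0 by case: i j ijk {IH x} => [|i] [|j].
  by subst j; rewrite /= deg_cast_id nh_diff0 scaler0 addr0 mulr1n.
rewrite nh_diffS IH // linearD !linearZZ /= exprS mulN1r scaleNr opprD addrA.
congr (_ - _).
case: i ijk {IH} => [|i] ijk /=; first by rewrite scale0r subr0.
by rewrite -scalerBl; case: (odd i) => /=; rewrite ?mulr0n ?mulr1n ?subr0 ?subrr.
Qed.

Definition nh_act i j k (a : Ts r i) (x : X j) : X k := (a : R) *: nh_iter i k x.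

Fact nh_act_shape i j k (a : Ts r i) (x : X j) : (i + j)%N != k -> nh_act k a x = 0.
Proof. by move=> ijk; rewrite /nh_act nh_iter_shape // scaler0. Qed.
Fact nh_act_linl i j k (x : X j) : linear (fun a : Ts r i => nh_act k a x).
Proof. by move=> c a b; rewrite /nh_act scalerDl scalerA. Qed.
Fact nh_act_linr i j k (a : Ts r i) : linear (fun x : X j => nh_act k a x).
Proof.
by move=> c x y; rewrite /nh_act nh_iter_linear scalerDr !scalerA [_ * c]mulrC.
Qed.
Fact nh_act1 i (x : X i) : nh_act i (dga_one (Ts r)) x = x.
Proof. by rewrite /nh_act /= deg_cast_id scale1r. Qed.
Fact nh_actA i j k (a : Ts r i) (b : Ts r j) (x : X k) :
  nh_act (i + j + k) (dga_mul (i + j) a b) x =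
  nh_act (i + j + k) a (nh_act (j + k) b x).
Proof.
rewrite /nh_act /= /T_mul eqxx nh_iterA (linear_scale (@nh_iter_linear _ _ _)).
by rewrite scalerA.
Qed.
Fact nh_act_leibniz i j k (a : Ts r i) (x : X j) : (i + j)%N = k.+1 ->
  cdiff X k (nh_act k.+1 a x) =
  nh_act k (bdiff a) x + (-1) ^+ i *: nh_act k a (bdiff x).
Proof.
move=> ijk; rewrite /nh_act linearZZ nh_iter_diff // scalerDr !scalerA.
congr (_ + _); last by rewrite mulrC.
case: i a {ijk} => [|i] a /=; first by rewrite mulr0.
by rewrite /T_diff; case: odd; rewrite /= ?mulr0n ?mulr0 // mulr1n mulrC.
Qed.

Definition nh_dgmod : dgmod (Ts r) :=
  Dgmod nh_act_shape nh_act_linl nh_act_linr nh_act1 nh_actA nh_act_leibniz.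

End KoszulAction.

Lemma nh_dgmod_act1 (R : comPzRingType) (X : cplx R) r (e : null_homotopy X r) i (x : X i) :
  dg_act (i.+1) (1 : Ts r 1%N) (x : nh_dgmod e i) = e i x.
Proof. by rewrite /= /nh_act /= deg_cast_id scale1r. Qed.

Section DgmodHomotopy.
Variables (R : comPzRingType) (r : R) (X : dgmod (Ts r)).

Definition dg_nh_fun i : {linear X i -> X i.+1} :=
  HB.pack_for {linear X i -> X i.+1} (fun x : X i => dg_act i.+1 (1 : Ts r 1%N) x)
    (GRing.isLinear.Build R (X i) (X i.+1) *:%R _
      (@act_linr _ _ X 1 i i.+1 (1 : Ts r 1%N))).

Fact dg_nhP i x : htpy dg_nh_fun i x = r *: x.
Proof. by case: i x => [|i] x; rewrite /= Ts_homotopy ?subrK //= act0r subr0 addr0. Qed.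

Definition dg_nh : null_homotopy X r := NullHomotopy dg_nhP.

Lemma dg_act_generator i j (a : Ts r i.+1) (x : X j) :
  dg_act (i.+1 + j) a x = dg_nh (i + j)%N (dg_act (i + j)%N (a : Ts r i) x).
Proof.
have := @actA _ _ X 1 i j (1 : Ts r 1%N) (a : Ts r i) x.
by rewrite /= /T_mul eqxx mul1r.
Qed.

End DgmodHomotopy.

Section DgmodMaps.
Variables (R : comPzRingType) (r : R) (X Y : dgmod (Ts r)) (u : cmap X Y).
Hypothesis u_nh : forall i x, u i.+1 (dg_nh X i x) = dg_nh Y i (u i x).

(** [T_r] is generated over [R] by [e], so commuting with [e] suffices: induction on the degree of
    [a], peeling off one [e] at a time. *)
Lemma Ts_act_comm i j k (a : Ts r i) (x : X j) : u k (dg_act k a x) = dg_act k a (u j x).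
Proof.
have [<-|ijk] := eqVneq (i + j)%N k; last by rewrite !act_shape // linear0.
elim: i a => [|i IH] a; last by rewrite !dg_act_generator u_nh IH.
have -> : a = (a : R) *: dga_one (Ts r) by exact/esym/mulr1.
rewrite (linear_scale (@act_linl _ _ X 0 j j x)).
by rewrite (linear_scale (@act_linl _ _ Y 0 j j _)) !act1 linearZZ.
Qed.

Definition Ts_dgmap : dgmap X Y := Dgmap Ts_act_comm.

End DgmodMaps.

(** * The classes [[X, e]] in the colimit *)

Section HomotopyClasses.
Variables (R : comPzRingType) (S : mulrClosed R) (n : option nat).
Implicit Types (X Y : cplx R) (s t u v : mset S).

Definition nh_perf (s : mset S) X (PX : in_P n X) (e : null_homotopy X (sval s)) :
  perf_dg (Ts (sval s)) n := exist _ (nh_dgmod e) PX.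

Definition nh_class s X PX (e : null_homotopy X (sval s)) : colim_G_T S n :=
  colim_in (G_T_tr n) s (G_dg_class (nh_perf PX e)).

Lemma dg_nhE s X (e : null_homotopy X (sval s)) i (x : X i) :
  dg_nh (nh_dgmod e) i x = e i x.
Proof. exact: nh_dgmod_act1. Qed.

Lemma nh_class_ses s X' X X'' PX' PX PX'' (e' : null_homotopy X' (sval s))
    (e : null_homotopy X (sval s)) (e'' : null_homotopy X'' (sval s))
    (f : cmap X' X) (g : cmap X X'') : degreewise_exact f g ->
    (forall i x, f i.+1 (e' i x) = e i (f i x)) ->
    (forall i x, g i.+1 (e i x) = e'' i (g i x)) ->
  nh_class PX e = nh_class PX' e' + nh_class PX'' e''.
Proof.
move=> fg fe ge; rewrite /nh_class -raddfD; congr (colim_in _ _ _).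
apply: groth_class_ses.
have fe' i x : f i.+1 (dg_nh (nh_dgmod e') i x) = dg_nh (nh_dgmod e) i (f i x).
  by rewrite [in RHS]dg_nhE [in LHS]dg_nhE.
have ge' i x : g i.+1 (dg_nh (nh_dgmod e) i x) = dg_nh (nh_dgmod e'') i (g i x).
  by rewrite [in RHS]dg_nhE [in LHS]dg_nhE.
by exists (@Ts_dgmap _ _ (nh_dgmod e') (nh_dgmod e) f fe'),
  (@Ts_dgmap _ _ (nh_dgmod e) (nh_dgmod e'') g ge').
Qed.

Lemma nh_class_acyclic s X PX (e : null_homotopy X (sval s)) :
  acyclic X -> nh_class PX e = 0.
Proof.
move=> aX; rewrite /nh_class.
by have -> : G_dg_class (nh_perf PX e) = 0; [exact: groth_class_acyc | exact: raddf0].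
Qed.

Lemma G_dg_class_iso r (X Y : perf_dg (Ts r) n) (u : cmap (sval X) (sval Y))
    (v : cmap (sval Y) (sval X)) :
    (forall i, cancel (u i) (v i) /\ cancel (v i) (u i)) ->
    (forall i x, u i.+1 (dg_nh (sval X) i x) = dg_nh (sval Y) i (u i x)) ->
  @G_dg_class R (Ts r) n X = @G_dg_class R (Ts r) n Y.
Proof.
move=> uv ue; apply: groth_class_eq.
apply/dg_classP; first exact: in_P_fg (svalP X).
have ve i y : v i.+1 (dg_nh (sval Y) i y) = dg_nh (sval X) i (v i y).
  have [[_ vK] [uK _]] := (uv i, uv i.+1).
  by apply: (can_inj uK); rewrite ue vK; have [_ ->] := uv i.+1.
by exists (Ts_dgmap ue), (Ts_dgmap ve).
Qed.

Definition cmap_id X : cmap X X := @Cmap R X X (fun i => idfun) (fun i x => erefl).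

Lemma nh_class_iso s X Y PX PY (e : null_homotopy X (sval s))
    (e' : null_homotopy Y (sval s)) (u : cmap X Y) (v : cmap Y X) :
    (forall i, cancel (u i) (v i) /\ cancel (v i) (u i)) ->
    (forall i x, u i.+1 (e i x) = e' i (u i x)) ->
  nh_class PX e = nh_class PY e'.
Proof.
move=> uv ue; congr (colim_in _ _ _).
apply: (@G_dg_class_iso _ (nh_perf PX e) (nh_perf PY e') u v uv) => i x.
by rewrite [in RHS]dg_nhE [in LHS]dg_nhE.
Qed.

Lemma nh_class_eq s t X PX PX' (e : null_homotopy X (sval s))
    (e' : null_homotopy X (sval t)) : sval s = sval t ->
  (forall i x, e i x = e' i x) -> nh_class PX e = nh_class PX' e'.
Proof.
move=> st; have {}st : s = t by exact: val_inj st.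
subst t => ee'; apply: (@nh_class_iso _ _ _ _ _ _ _ (cmap_id X) (cmap_id X)) => //.
Qed.

(** A [T_s]-module is recovered from its underlying complex and the action of [e], so the classes
    [[X, e]] generate the colimit. *)
Lemma nh_class_dg s (X : perf_dg (Ts (sval s)) n) :
  colim_in (G_T_tr n) s (G_dg_class X) = nh_class (svalP X) (dg_nh (sval X)).
Proof.
congr (colim_in _ _ _).
apply: (@G_dg_class_iso _ X (nh_perf (svalP X) (dg_nh (sval X)))
  (cmap_id (sval X)) (cmap_id (sval X))) => // i x.
by rewrite [in RHS]dg_nhE.
Qed.

Section Scale.
Variables (r : R) (X : cplx R) (e : null_homotopy X r) (t : R).

Fact nh_scaleP i x : htpy (fun i => t \*: e i) i x = (r * t) *: x.
Proof.
rewrite mulrC -scalerA -(nhP e) /= linearZZ scalerDr; congr (_ + _).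
by case: i x => [|i] x //=; rewrite scaler0.
Qed.

Definition nh_scale : null_homotopy X (r * t) := NullHomotopy nh_scaleP.
End Scale.

(** The transition map restricts along [e |-> t e], so it turns the null-homotopy [e] of [s] into
    [t e]; the colimit identifies the two. *)
Lemma nh_class_scale s X PX (e : null_homotopy X (sval s)) t :
  nh_class PX e = @nh_class (msetM s t) X PX (nh_scale e (sval t)).
Proof.
rewrite /nh_class -(colim_in_tr (G_T_tr n) t); congr (colim_in _ _ _).
transitivity (G_dg_class (restrict_perf (T_map (sval s) (sval t)) (nh_perf PX e))).
  exact: G_restrictE.
apply: (@G_dg_class_iso _ (restrict_perf (T_map (sval s) (sval t)) (nh_perf PX e))
   (@nh_perf (msetM s t) X PX (nh_scale e (sval t))) (cmap_id X) (cmap_id X)) => // i x.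
rewrite [RHS](@dg_nhE (msetM s t)) /= /res_act /= /T_map_fun expr1 mulr1.
by rewrite /nh_act /= deg_cast_id.
Qed.

Lemma nh_class_scale_eq s t u v X PX PX' (e : null_homotopy X (sval s))
    (e' : null_homotopy X (sval t)) : sval s * sval u = sval t * sval v ->
  (forall i x, sval u *: e i x = sval v *: e' i x) -> nh_class PX e = nh_class PX' e'.
Proof.
move=> suv ee'; rewrite (nh_class_scale _ _ u) (nh_class_scale _ e' v).
exact: nh_class_eq.
Qed.

End HomotopyClasses.

(** * Lifting from finitely generated projectives up to [S] *)

Section Projective.
Variable R : comPzRingType.
Implicit Types M N P : lmodType R.

Definition row_comb M k (g : 'I_k -> M) (v : 'rV[R]_k) : M := comb g (v 0).

Lemma row_comb_linear M k (g : 'I_k -> M) : linear (row_comb g).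
Proof. by move=> a v w; rewrite -combP; apply: eq_bigr => j _; rewrite !mxE. Qed.

HB.instance Definition _ M k (g : 'I_k -> M) :=
  GRing.isLinear.Build R 'rV[R]_k M *:%R (row_comb g) (row_comb_linear g).

Lemma dual_basis P : fin_gen P -> projective P ->
  exists k (g : 'I_k -> P) (c : {linear P -> 'rV[R]_k}), forall x, row_comb g (c x) = x.
Proof.
move=> [k [g gen_g]] projP; exists k, g.
apply: (projP _ _ (row_comb g) idfun) => y.
have [v gv] := gen_g y; exists (\row_j v j).
by rewrite -[RHS]gv; apply: eq_bigr => j _; rewrite mxE.
Qed.

(** Each of the finitely many generators lifts up to its own denominator. The product of these is a
    common denominator, and dual coordinates turn the lifts of generators into a linear map. *)
Lemma loc_lift (S : mulrClosed R) P M N (f : {linear P -> N}) (p : {linear M -> N}) :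
    fin_gen P -> projective P ->
    (forall x, exists u : mset S, exists m, p m = sval u *: f x) ->
  exists (u : mset S) (h : {linear P -> M}), forall x, p (h x) = sval u *: f x.
Proof.
move=> fgP projP fp; have [k [g [c cK]]] := dual_basis fgP projP.
pose u j := sval (cid (fp (g j))).
have /choice[m pm] j : exists m, p m = sval (u j) *: f (g j) := svalP (cid (fp (g j))).
have uS : \prod_j sval (u j) \in S by apply: rpred_prod => j _; exact: valP (u j).
(* The complementary product raises the denominator [u j] to the common one. *)
pose m' j := (\prod_(i | i != j) sval (u i)) *: m j.
exists (exist (fun s => s \in S) _ uS), (row_comb m' \o c) => x /=.
have -> : f x = comb (fun j => f (g j)) (c x 0) by rewrite -comb_lin [comb g _]cK.
rewrite /row_comb comb_lin /comb scaler_sumr; apply: eq_bigr => j _.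
rewrite linearZZ pm !scalerA /= [X in _ = (X * _) *: _](bigD1 j) //=.
by congr (_ *: _); ring.
Qed.

End Projective.

(** * Torsion homology and existence of null-homotopies *)

Section Existence.
Variables (R : comPzRingType) (S : mulrClosed R).
Implicit Types X Y Z : cplx R.

Definition torsion_homology X : Prop :=
  forall i (x : X i), bdiff x = 0 \/ i = 0 ->
    exists u : mset S, exists y, cdiff X i y = sval u *: x.

(** If [y/t] bounds [x/1] in the localization, some [u] in [S] gives [d (u y) = u t x]. *)
Lemma loc_acyclic_torsion X : acyclic (loc_cplx S X) -> torsion_homology X.
Proof.
move=> [aX0 aX].
have tor i (x : X i) (z : loc S (X i.+1)) :
    loc_map S (cdiff X i) z = frac x (mset1 S) ->
  exists u : mset S, exists y, cdiff X i y = sval u *: x.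
  have [y [t ->]] := fracP z; rewrite /= loc_funE => /frac_eq[u /= ux].
  exists (msetM u t), (sval u *: y).
  by rewrite linearZZ -scalerA -ux scale1r.
case=> [|i] x dx; first by have [z /tor] := aX0 (frac x (mset1 S)).
suff /aX[z /tor] : loc_map S (cdiff X i) (frac x (mset1 S)) = 0 by [].
rewrite /= loc_funE; apply/frac_eq0; exists (mset1 S).
by case: dx => //= ->; rewrite scaler0.
Qed.

Lemma nh_torsion X (s : mset S) : null_homotopy X (sval s) -> torsion_homology X.
Proof.
move=> e i x dx; exists s, (e i x); rewrite -(nhP e) /=.
by case: i x dx => [|i] x /= => [_|[] // ->]; rewrite ?linear0 addr0.
Qed.

(** In the long exact sequence [H_i X] sits between [H_(i+1) Z] and [H_i Y]. This is the
    corresponding chase, up to [S]. *)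
Lemma ses_torsion X Y Z (f : cmap X Y) (g : cmap Y Z) : degreewise_exact f g ->
  torsion_homology Y -> torsion_homology Z -> torsion_homology X.
Proof.
move=> fg torY torZ i x dx.
have [u [w dw]] : exists u : mset S, exists w, cdiff Y i w = sval u *: f i x.
  apply: torY; case: i x dx => [|i] x; [by right | case=> // dx; left].
  by rewrite /= -cmap_diff [cdiff X i x]dx linear0.
have gw : cdiff Z i (g i.+1 w) = 0.
  rewrite -cmap_diff dw linearZZ; have [_ gf _] := fg i.
  by have /gf -> : exists x', f i x' = f i x; [exists x | rewrite scaler0].
have [v [z dz]] := torZ i.+1 (g i.+1 w) (or_introl gw).
have [_ _ g_surj] := fg i.+2; have [w2 gw2] := g_surj z.
have [_ gf _] := fg i.+1.
(* Subtracting the boundary of a lift of [z] moves [v w] into [X] without changing its boundary. *)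
have /gf[y fy] : g i.+1 (sval v *: w - cdiff Y i.+1 w2) = 0.
  by rewrite linearB linearZZ cmap_diff gw2 dz subrr.
have [f_inj _ _] := fg i.
exists (msetM v u), y; apply: f_inj.
by rewrite cmap_diff fy linearB linearZZ cdiff_sq subr0 dw [RHS]linearZZ scalerA.
Qed.

(** Induction on degree: if [e] works below [m], then [s - e d] maps [X m] to cycles (anything when
    [m = 0]), which are boundaries up to [S]; [loc_lift] gives the next map at the cost of a factor
    [u] in the degrees below. Since [X] is bounded, finitely many factors occur. *)
Lemma nh_exists X n : in_P n X -> torsion_homology X ->
  exists s : mset S, exists e : null_homotopy X (sval s), True.
Proof.
move=> [fgpX [N X0] _] torX.
suff partial m : exists (s : mset S) (e : forall i, {linear X i -> X i.+1}),
    forall i, (i < m)%N -> forall x, htpy e i x = sval s *: x.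
  have [s [e eP]] := partial N.+1; exists s.
  suff nhe i x : htpy e i x = sval s *: x by exists (NullHomotopy nhe).
  have [/eP //|Ni] := ltnP i N.+1.
  by rewrite [LHS](X0 i) // [RHS](X0 i).
elim: m => [|m [s [e eP]]]; first by exists (mset1 S), (fun i => \0).
have [fgXm projXm] := fgpX m.
have [] := @loc_lift R S (X m) (X m.+1) (X m) ((sval s \*: idfun) \- nh_prev e m)
  (cdiff X m) fgXm projXm.
  move=> x; apply: torX; case: m eP x {fgXm projXm} => [|m] eP x; [by right | left].
  rewrite /= linearB linearZZ -(eP m (ltnSn _)) /=.
  by rewrite nh_prev_diff addr0 subrr.
move=> u [h hP].
pose eu i : {linear X i -> X i.+1} := sval u \*: e i.
pose T i : Type := {linear X i -> X i.+1}.
pose e' : forall i, {linear X i -> X i.+1} := @dfwith nat T eu m h.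
have e'out i : (i < m)%N -> e' i = eu i.
  by move=> im; rewrite /e' dfwith_out // eq_sym neq_ltn im.
exists (msetM s u), e'.
have prevE i x : (i <= m)%N -> nh_prev e' i x = sval u *: nh_prev e i x.
  by case: i x => [|i] x im /=; rewrite ?scaler0 // e'out.
move=> i; rewrite ltnS => im x; rewrite /= prevE // mulrC -scalerA.
have [im'|mi] := ltnP i m; first by rewrite e'out // -eP //= linearZZ scalerDr.
have {im mi} im : i = m by apply/eqP; rewrite eqn_leq im.
by subst i; rewrite /e' dfwith_in hP /= -scalerDr subrK.
Qed.

End Existence.

(** * Null-homotopies in short exact sequences, and additivity *)

Section Extension.
Variables (R : comPzRingType) (X' X X'' : cplx R) (f : cmap X' X) (g : cmap X X'').
Hypothesis fg : degreewise_exact f g.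
Hypothesis projX'' : forall i, projective (X'' i).

Let f_inj i : injective (f i). Proof. by have [] := fg i. Qed.
Let gf i y : g i y = 0 <-> exists x, f i x = y. Proof. by have [_ h _] := fg i. Qed.

Lemma ses_split i : exists (p : {linear X i -> X' i}) (j : {linear X'' i -> X i}),
  [/\ forall x, p (f i x) = x, forall z, g i (j z) = z
    & forall y, f i (p y) + j (g i y) = y].
Proof.
have [_ _ g_surj] := fg i.
have [j jK] := projX'' idfun g_surj.
have fp y : exists x, f i x = y - j (g i y) by apply/gf; rewrite linearB jK subrr.
pose p y := sval (cid (fp y)).
have pP y : f i (p y) = y - j (g i y) := svalP (cid (fp y)).
have p_lin : linear p.
  move=> a x y; apply: (@f_inj i); rewrite linearP !pP [g i _]linearP [j _]linearP.
  by rewrite scalerBr opprD addrACA.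
exists (HB.pack_for {linear X i -> X' i} p
  (GRing.isLinear.Build R (X i) (X' i) *:%R p p_lin)), j.
split=> [x|z|y] /=; [|exact: jK|by rewrite pP subrK].
apply: (@f_inj i); rewrite pP.
by have -> : g i (f i x) = 0; [apply/gf; exists x | rewrite linear0 subr0].
Qed.

(** Any degreewise lift [e0] of the two null-homotopies has [d e0 + e0 d = s + c]
    with [c] vanishing on [X'] and into [X''], so that [c^2 = 0] and
    [(s - c) e0] is a null-homotopy of [s^2]. *)
Lemma nh_extend s (e' : null_homotopy X' s) (e'' : null_homotopy X'' s) :
  exists e : null_homotopy X (s * s),
    (forall i x, f i.+1 (nh_scale e' s i x) = e i (f i x)) /\
    (forall i x, g i.+1 (e i x) = nh_scale e'' s i (g i x)).
Proof.
have [e0 [fe0 ge0]] : exists e0 : forall i, {linear X i -> X i.+1},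
    (forall i x, f i.+1 (e' i x) = e0 i (f i x)) /\
    (forall i x, g i.+1 (e0 i x) = e'' i (g i x)).
  pose p i := sval (cid (ses_split i)).
  pose j i := sval (cid (svalP (cid (ses_split i)))).
  have pj i : [/\ forall x, p i (f i x) = x, forall z, g i (j i z) = z
      & forall y, f i (p i y) + j i (g i y) = y] :=
    svalP (cid (svalP (cid (ses_split i)))).
  exists (fun i => (f i.+1 \o e' i \o p i) \+ (j i.+1 \o e'' i \o g i)).
  have gf0 i x : g i (f i x) = 0 by apply/gf; exists x.
  split=> i x /=.
    by have [-> _ _] := pj i; rewrite gf0 !linear0 addr0.
  by rewrite linearD gf0 add0r; have [_ -> _] := pj i.+1.
have Df := htpy_nat fe0; have Dg := htpy_nat ge0.
(* With [htpy e0 = s + c], the factor [2 s - htpy e0] is [s - c]. *)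
pose e i : {linear X i -> X i.+1} :=
  (((s + s) \*: idfun) \- htpy e0 i.+1) \o e0 i.
have eE i x : e i x = (s + s) *: e0 i x - htpy e0 i.+1 (e0 i x) by [].
have prevE i x : nh_prev e i x = (s + s) *: nh_prev e0 i x - htpy e0 i (nh_prev e0 i x).
  case: i x => [|i] x //; have prev0 a : @nh_prev R X a 0 x = 0 by [].
  by rewrite !prev0 !linear0 addr0.
(* For [D = htpy e0] this says [(D - s)^2 = 0]: [D - s] lands in [X'], where [D] is [s]. *)
have D2 i x : htpy e0 i (htpy e0 i x) = (s + s) *: htpy e0 i x - (s * s) *: x.
  have /gf[y fy] : g i (htpy e0 i x - s *: x) = 0.
    by rewrite linearB Dg nhP linearZZ subrr.
  have : htpy e0 i (f i y) = s *: f i y by rewrite -Df nhP linearZZ.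
  rewrite fy linearB linearZZ scalerBr scalerA => /(canRL (subrK _)) ->.
  by rewrite scalerDl addrAC.
(* As [D] commutes with [d], the new homotopy gives [(2 s - D) D = s^2]. *)
have eP i x : htpy e i x = (s * s) *: x.
  have -> : htpy e i x = cdiff X i (e i x) + nh_prev e i x by [].
  rewrite eE prevE linearB linearZZ htpy_diff addrACA -scalerDr -opprD -linearD.
  rewrite -[cdiff X i (e0 i x) + _]/(htpy e0 i x) D2.
  by rewrite opprB addrC subrK.
exists (NullHomotopy eP); split=> i x.
  rewrite [RHS]eE -fe0 -Df nhP [X in _ - X]linearZZ -scalerBl addrK.
  exact: linearZZ.
by rewrite [NullHomotopy eP i x]eE linearB Dg nhP [X in X - _]linearZZ ge0 -scalerBl addrK.
Qed.

End Extension.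

Section Additivity.
Variables (R : comPzRingType) (S : mulrClosed R) (n : option nat).

(** Both ends are scaled to the common index [t = s s'']; the passage from [t] to [t^2] made by
    [nh_extend] is invisible in the colimit. *)
Lemma nh_class_extend (X' X X'' : cplx R) (f : cmap X' X) (g : cmap X X'')
    (PX' : in_P n X') (PX : in_P n X) (PX'' : in_P n X'') (s s'' : mset S)
    (e' : null_homotopy X' (sval s)) (e'' : null_homotopy X'' (sval s'')) :
    degreewise_exact f g ->
  exists (t : mset S) (e : null_homotopy X (sval t)),
    nh_class PX e = nh_class PX' e' + nh_class PX'' e''.
Proof.
move=> fg; have projX'' i : projective (X'' i) by have [/(_ i)[]] := PX''.
have [a ->] : exists a : null_homotopy X'' (sval (msetM s s'')),
    nh_class PX'' e'' = nh_class PX'' a.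
  have ss : msetM s'' s = msetM s s'' by apply: val_inj; exact: mulrC.
  rewrite (nh_class_scale _ e'' s).
  (* The index occurs in the type of the homotopy, which is therefore generalized before [s'' s] is
     rewritten. *)
  move: (nh_scale e'' (sval s) : null_homotopy X'' (sval (msetM s'' s))).
  by rewrite ss => a; exists a.
rewrite (nh_class_scale _ e' s'').
move: (nh_scale e' (sval s'') : null_homotopy X' (sval (msetM s s''))) => b.
pose t := msetM s s''.
have [e [fe ge]] := nh_extend fg projX'' b a.
exists (msetM t t), e; rewrite (nh_class_scale _ a t) (nh_class_scale _ b t).
exact: (@nh_class_ses _ _ _ (msetM t t) _ _ _ PX' PX PX''
  (nh_scale b (sval t)) e (nh_scale a (sval t)) f g fg fe ge).
Qed.

End Additivity.

(** * Products of modules and direct sums of complexes *)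

Section Products.
Variable R : comPzRingType.
Implicit Types M N P Q : lmodType R.

Definition pair_fun M P Q (f : M -> P) (g : M -> Q) (x : M) : P * Q := (f x, g x).

Lemma pair_fun_linear M P Q (f : {linear M -> P}) (g : {linear M -> Q}) :
  linear (pair_fun f g).
Proof. by move=> a x y; rewrite /pair_fun !linearP. Qed.

HB.instance Definition _ M P Q (f : {linear M -> P}) (g : {linear M -> Q}) :=
  GRing.isLinear.Build R M (P * Q)%type *:%R (pair_fun f g) (pair_fun_linear f g).

Lemma fin_gen_prod P Q : fin_gen P -> fin_gen Q -> fin_gen (P * Q)%type.
Proof.
move=> [k [g gen_g]] [l [h gen_h]]; exists (k + l)%N.
exists (fun i => match split i with inl i1 => (g i1, 0) | inr i2 => (0, h i2) end).
move=> [x y]; have [v <-] := gen_g x; have [w <-] := gen_h y.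
exists (fun i => match split i with inl i1 => v i1 | inr i2 => w i2 end).
rewrite /comb big_split_ord /=.
under eq_bigr => i _ do rewrite (unsplitK (inl i)).
under [X in _ + X]eq_bigr => i _ do rewrite (unsplitK (inr i)).
rewrite [LHS]surjective_pairing !linearD !linear_sum /=.
by congr pair; [rewrite [X in _ + X]big1 ?addr0 | rewrite big1 ?add0r] => // i _;
  rewrite scaler0.
Qed.

Lemma projective_prod P Q : projective P -> projective Q -> projective (P * Q)%type.
Proof.
move=> projP projQ M N p f p_surj.
have [h hP] := projP M N p (f \o pair_fun idfun \0) p_surj.
have [l lP] := projQ M N p (f \o pair_fun \0 idfun) p_surj.
exists ((h \o fst) \+ (l \o snd)) => -[x y].
have xyE : (x, y) = (x, 0) + (0, y) by congr pair; rewrite ?addr0 ?add0r.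
by rewrite [in RHS]xyE [RHS]linearD [LHS]linearD; congr (_ + _); [exact: hP | exact: lP].
Qed.

Lemma fin_gen_projective_prod P Q :
  fin_gen P /\ projective P -> fin_gen Q /\ projective Q ->
  fin_gen (P * Q)%type /\ projective (P * Q)%type.
Proof.
by move=> [? ?] [? ?]; split; [exact: fin_gen_prod | exact: projective_prod].
Qed.

Lemma zero_mod_rV0 : zero_mod 'rV[R]_0.
Proof. exact: thinmx0. Qed.

Lemma fin_gen_zero M : zero_mod M -> fin_gen M.
Proof.
by move=> M0; exists 0, (fun=> 0) => x;
  exists (fun=> 0); rewrite [RHS]M0 [LHS]M0.
Qed.

Lemma projective_zero M : zero_mod M -> projective M.
Proof. by move=> M0 A B p f _; exists \0 => x; rewrite (M0 x) !linear0. Qed.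

End Products.

Section DirectSum.
Variables (R : comPzRingType) (Y K : cplx R).

Definition dsum_mod i : lmodType R := (Y i * K i)%type.
Definition dsum_diff i : {linear dsum_mod i.+1 -> dsum_mod i} :=
  pair_fun (cdiff Y i \o fst) (cdiff K i \o snd).
Fact dsum_diff_sq i x : dsum_diff i (dsum_diff i.+1 x) = 0.
Proof. by rewrite /= /pair_fun /= !cdiff_sq. Qed.
Definition dsum : cplx R := Cplx dsum_diff_sq.

Definition dsum_inl : cmap Y dsum :=
  @Cmap R Y dsum (fun i => pair_fun idfun \0)
    (fun i x => congr1 (pair _) (esym (linear0 _))).
Definition dsum_inr : cmap K dsum :=
  @Cmap R K dsum (fun i => pair_fun \0 idfun)
    (fun i x => congr1 (pair^~ _) (esym (linear0 _))).
Definition dsum_fst : cmap dsum Y := @Cmap R dsum Y (fun i => fst) (fun i x => erefl).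
Definition dsum_snd : cmap dsum K := @Cmap R dsum K (fun i => snd) (fun i x => erefl).

Lemma dsum_exact : degreewise_exact dsum_inl dsum_snd.
Proof.
move=> i; split=> [x y []|[y k]|k] //; last by exists (0, k).
by split=> /= [->|[x [_ <-]]] //; exists y.
Qed.

(** Null-homotopies pass to retracts; this serves both for direct summands and for transport along
    isomorphisms. *)
Lemma htpy_compress (A B : cplx R) (f : cmap A B) (g : cmap B A) r (e : null_homotopy B r) :
    (forall i, cancel (f i) (g i)) ->
  forall i x, htpy (fun i => g i.+1 \o e i \o f i) i x = r *: x.
Proof.
move=> fK i x; rewrite -[in RHS](fK i x) -linearZZ -(nhP e) /= linearD cmap_diff.
by congr (_ + _); case: i x => [|i] x /=; rewrite ?linear0 // cmap_diff.
Qed.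

Definition compress (A B : cplx R) (f : cmap A B) (g : cmap B A) r (e : null_homotopy B r)
    (fK : forall i, cancel (f i) (g i)) : null_homotopy A r :=
  NullHomotopy (htpy_compress e fK).

End DirectSum.

(** * The complex [K], and the class of its sum with an acyclic complex *)

Section Koszul.
Variables (R : comPzRingType) (P : lmodType R) (s : R).

Definition koszul_mod i : lmodType R :=
  match i with 0 | 1 => P | _ => 'rV[R]_0 end.
Definition koszul_diff i : {linear koszul_mod i.+1 -> koszul_mod i} :=
  match i with 0 => s \*: idfun | _ => \0 end.
Fact koszul_diff_sq i x : koszul_diff i (koszul_diff i.+1 x) = 0.
Proof. by case: i x => [|i] x //=; rewrite scaler0. Qed.
Definition koszul : cplx R := Cplx koszul_diff_sq.

Definition koszul_nh_fun i : {linear koszul i -> koszul i.+1} :=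
  match i with 0 => idfun | _ => \0 end.
Fact koszul_nhP i x : htpy koszul_nh_fun i x = s *: x.
Proof.
case: i x => [|[|i]] x /=; [by rewrite addr0 | by rewrite add0r |].
by rewrite [LHS]zero_mod_rV0 [RHS]zero_mod_rV0.
Qed.
Definition koszul_nh : null_homotopy koszul s := NullHomotopy koszul_nhP.

End Koszul.

Section KoszulClass.
Variables (R : comPzRingType) (S : mulrClosed R) (n : option nat).
Variables (Y : cplx R) (P : lmodType R) (s : mset S).
Let K := koszul P (sval s).
Hypotheses (PY : in_P n Y) (PK : in_P n K) (PW : in_P n (dsum Y K)) (acY : acyclic Y).

(** Up to multiplication by [s], the components [Y -> K] and [K -> K] of any
    null-homotopy of [Y (+) K] are forced, because [s] is the differential of [K]. *)
Lemma dsum_koszul_nh t (e : null_homotopy (dsum Y K) t) y (k : K 0) :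
  sval s *: (e 0 (y, k)).2 = t *: k.
Proof. by have := congr1 snd (nh_diff0 e (y, k)). Qed.

Lemma nh_class_dsum_koszul (t : mset S) (e : null_homotopy (dsum Y K) (sval t)) :
  nh_class PW e = nh_class PK (koszul_nh P (sval s)).
Proof.
rewrite (nh_class_scale _ e s); set e' := nh_scale e (sval s).
have inlK i : cancel (dsum_inl Y K i) (dsum_fst Y K i) by [].
have inrK i : cancel (dsum_inr Y K i) (dsum_snd Y K i) by [].
pose eY := compress e' inlK; pose eK := compress e' inrK.
(* So [Y] is stable under [e']: in degree 0 the [K]-component is [t] times 0, and above that [K]
   vanishes in the target degree. *)
have e'snd i y : (e' i (y, 0)).2 = 0.
  case: i y => [|i] y; first by rewrite [LHS]dsum_koszul_nh scaler0.
  exact: zero_mod_rV0.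
have e'inl i y : dsum_inl Y K i.+1 (eY i y) = e' i (dsum_inl Y K i y).
  by rewrite /= /pair_fun [RHS]surjective_pairing e'snd.
have e'snd' i w : dsum_snd Y K i.+1 (e' i w) = eK i (dsum_snd Y K i w).
  case: w => y k; have wE : (y, k) = (y, 0) + (0, k) :> dsum Y K i.
    by congr pair; rewrite ?addr0 ?add0r.
  by rewrite [in LHS]wE linearD [LHS]linearD [X in X + _]e'snd add0r.
rewrite (@nh_class_ses _ _ _ (msetM t s) _ _ _ PY PW PK eY e' eK
  (dsum_inl Y K) (dsum_snd Y K) (dsum_exact Y K) e'inl e'snd').
rewrite nh_class_acyclic // add0r.
(* The null-homotopy induced on [K] is [t] times the standard one, for the index [t s] instead of
   [s]. *)
apply: (@nh_class_scale_eq _ _ _ (msetM t s) s (mset1 S) t) => [|i k] /=.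
  by rewrite mulr1 mulrC.
case: i k => [|i] k; last by rewrite [LHS]zero_mod_rV0 [RHS]zero_mod_rV0.
by rewrite scale1r /= [LHS]dsum_koszul_nh.
Qed.

End KoszulClass.

(** * The cover [W] of [X] by disks and [K], and its kernel [Z] *)

Section KoszulCover.
Variables (R : comPzRingType) (X : cplx R) (s : R) (e : null_homotopy X s).

(** The sum over [i >= 1] of the complexes [X_i = X_i] in degrees [i], [i - 1]. *)
Definition disks_mod i : lmodType R :=
  match i with 0 => X 1 | j.+1 => (X j.+1 * X j.+2)%type end.
Definition disks_diff i : {linear disks_mod i.+1 -> disks_mod i} :=
  match i with 0 => fst | j.+1 => pair_fun \0 fst end.
Fact disks_diff_sq i x : disks_diff i (disks_diff i.+1 x) = 0.
Proof. by case: i x => [|i]. Qed.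
Definition disks : cplx R := Cplx disks_diff_sq.

Lemma disks_acyclic : acyclic disks.
Proof.
split=> [x|[|i] [x y] /=]; first by exists (x, 0).
- by move=> ->; exists (y, 0).
- by move=> [->]; exists (y, 0).
Qed.

(** On the disk of [X_i]: the identity in degree [i], which forces [d] in degree [i - 1]. *)
Definition disks_map_fun i : {linear disks i -> X i} :=
  match i with 0 => cdiff X 0 | j.+1 => fst \+ (cdiff X j.+1 \o snd) end.
Fact disks_map_diff i x :
  disks_map_fun i (cdiff disks i x) = cdiff X i (disks_map_fun i.+1 x).
Proof.
by case: i x => [|i] x /=; rewrite linearD cdiff_sq addr0 // add0r.
Qed.

Definition cover : cplx R := dsum disks (koszul (X 0) s).

Definition koszul_map_fun i : {linear koszul (X 0) s i -> X i} :=
  match i with 0 => idfun | 1 => e 0 | _ => \0 end.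
Fact koszul_map_diff i x :
  koszul_map_fun i (cdiff (koszul (X 0) s) i x) = cdiff X i (koszul_map_fun i.+1 x).
Proof.
by case: i x => [|[|i]] x /=; rewrite ?linear0 // nh_diff0.
Qed.

Fact cover_map_diff i x :
  ((disks_map_fun i \o fst) \+ (koszul_map_fun i \o snd)) (cdiff cover i x) =
  cdiff X i (((disks_map_fun i.+1 \o fst) \+ (koszul_map_fun i.+1 \o snd)) x).
Proof.
by rewrite [RHS]linearD -[X in X + _]disks_map_diff -[X in _ + X]koszul_map_diff.
Qed.
Definition cover_map : cmap cover X := Cmap cover_map_diff.

(** The kernel [Z], in coordinates. In each degree [cover_map] is the identity on one summand [X_i]
    of [W], so its kernel is a graph over the other summands, listed here; its terms are thus
    visibly finitely generated projective. *)
Definition syz_mod i : lmodType R :=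
  match i with 0 => X 1 | 1 => (X 2 * X 0)%type | j.+2 => X j.+3 end.
Definition syz_diff0 : {linear syz_mod 1 -> syz_mod 0} :=
  -%R \o ((cdiff X 1 \o fst) \+ (e 0 \o snd)).
(** The differential of [W] moves the dependent coordinate [-(d y + ...)] into a free one, whence
    the signs. *)
Definition syz_diff i : {linear syz_mod i.+1 -> syz_mod i} :=
  match i with
  | 0 => syz_diff0
  | 1 => pair_fun (-%R \o cdiff X 2) \0
  | j.+2 => -%R \o cdiff X j.+3
  end.
Fact syz_diff_sq i x : syz_diff i (syz_diff i.+1 x) = 0.
Proof.
case: i x => [|[|i]] x /=; rewrite /pair_fun /=.
- by rewrite linear0 addr0 linearN cdiff_sq !oppr0.
- by rewrite linearN cdiff_sq !oppr0.
- by rewrite linearN cdiff_sq !oppr0.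
Qed.
Definition syz : cplx R := Cplx syz_diff_sq.

Definition syz_map_fun i : {linear syz i -> cover i} :=
  match i return {linear syz i -> cover i} with
  | 0 => pair_fun idfun (-%R \o cdiff X 0)
  | 1 => pair_fun (pair_fun syz_diff0 fst) snd
  | j.+2 => pair_fun (pair_fun (-%R \o cdiff X j.+2) idfun) \0
  end.
Fact syz_map_diff i x :
  syz_map_fun i (cdiff syz i x) = cdiff cover i (syz_map_fun i.+1 x).
Proof.
case: i x => [|[|i]] x /=; rewrite /pair_fun /=.
- by rewrite [cdiff X 0 _]linearN opprK [cdiff X 0 _]linearD cdiff_sq add0r nh_diff0.
- by rewrite /pair_fun /= linear0 addr0 linearN cdiff_sq !oppr0.
- by rewrite /pair_fun /= [cdiff X i.+2 _]linearN cdiff_sq !oppr0.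
Qed.
Definition syz_map : cmap syz cover := Cmap syz_map_diff.

Lemma cover_exact : degreewise_exact syz_map cover_map.
Proof.
case=> [|[|i]]; split.
- by move=> x y [].
- move=> [y k] /=; split=> [/eqP|[x [<- <-]]]; last by rewrite subrr.
  by rewrite addrC addr_eq0 => /eqP ->; exists y.
- by move=> z; exists (0, z); rewrite /= linear0 add0r.
- by move=> [x k] [y l] [_ -> ->].
- move=> [[y y'] k] /=; split=> [/eqP|[[x l] [<- <- <-]]].
    rewrite -addrA addr_eq0 => /eqP ->; by exists (y', k).
  by rewrite -addrA addNr.
- by move=> z; exists ((z, 0), 0); rewrite /= !linear0 !addr0.
- by move=> x y [].
- move=> [[y y'] k] /=; split=> [/eqP|[x [<- <- _]]]; last by rewrite addr0 addNr.
  rewrite addr0 addr_eq0 => /eqP ->; exists y'.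
  by rewrite /pair_fun /= (zero_mod_rV0 k).
- by move=> z; exists ((z, 0), 0); rewrite /= linear0 !addr0.
Qed.

Section Perfect.
Variables (n : option nat) (n_ge1 : leq_oo 1 n) (PX : in_P n X).

(** Here [n >= 1] enters: degrees 0 and 1 are always allowed, and from degree 2 on [C] vanishes
    where [X] does in this and the next degree. *)
Lemma in_P_shift (C : cplx R) : (forall i, fin_gen (C i) /\ projective (C i)) ->
    (forall i, zero_mod (X i.+2) -> zero_mod (X i.+3) -> zero_mod (C i.+2)) ->
  in_P n C.
Proof.
move=> fgpC C0; have [_ [N X0] Xn] := PX; split=> //.
  (* The bound is [N + 1] because [C 1] may be nonzero even for [N = 0]. *)
  exists N.+1 => -[|[|i]] // Ni; apply: C0; apply: X0; first exact: ltnW.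
  by rewrite ltnS ltnW // ltnW.
move=> [|[|i]] ni; [by case: n ni|by rewrite n_ge1 in ni|].
apply: C0; apply: Xn => //; apply: contra ni.
by case: n => //= m; exact: ltnW.
Qed.

Let fgpX i : fin_gen (X i) /\ projective (X i). Proof. by have [h _ _] := PX. Qed.

Lemma in_P_disks : in_P n disks.
Proof.
apply: in_P_shift => [[|i]|i X0 X1 [x y]]; first exact: fgpX.
  exact: fin_gen_projective_prod.
by rewrite (X0 x) (X1 y).
Qed.

Lemma in_P_koszul : in_P n (koszul (X 0) s).
Proof.
apply: in_P_shift => [[|[|i]]|i _ _]; [exact: fgpX | exact: fgpX | |exact: zero_mod_rV0].
by split; [apply: fin_gen_zero | apply: projective_zero]; exact: zero_mod_rV0.
Qed.

Lemma in_P_cover : in_P n cover.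
Proof.
have [fgpY _ _] := in_P_disks; have [fgpK _ _] := in_P_koszul.
apply: in_P_shift => [i|i X0 X1 [[x y] z]]; first exact: fin_gen_projective_prod.
by rewrite (X0 x) (X1 y) (zero_mod_rV0 z).
Qed.

Lemma in_P_syz : in_P n syz.
Proof.
apply: in_P_shift => [[|[|i]]|i _ X1]; [exact: fgpX | | exact: fgpX | exact: X1].
exact: fin_gen_projective_prod.
Qed.

End Perfect.
End KoszulCover.

(** * Independence of the null-homotopy, and the inverse map *)

Section Independence.
Variables (R : comPzRingType) (S : mulrClosed R) (n : option nat).
Hypothesis n_ge1 : leq_oo 1 n.

Lemma acyclic_torsion (X : cplx R) : acyclic X -> torsion_homology S X.
Proof.
move=> [aX0 aX] i x dx; exists (mset1 S); rewrite /= scale1r.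
by case: i x dx => [|i] x => [_|[dx|//]]; [exact: aX0 | exact: aX].
Qed.

Lemma dsum_torsion (X Y : cplx R) :
  torsion_homology S X -> torsion_homology S Y -> torsion_homology S (dsum X Y).
Proof.
move=> torX torY i [x y] dxy.
have [dx dy] : (bdiff x = 0 \/ i = 0) /\ (bdiff y = 0 \/ i = 0).
  by case: i x y dxy => [|i] x y; [split; right | case=> // -[dx dy]; split; left].
have [u [x1 dx1]] := torX i x dx; have [v [y1 dy1]] := torY i y dy.
exists (msetM u v), (sval v *: x1, sval u *: y1).
rewrite /= /pair_fun /= !linearZZ dx1 dy1.
by congr pair; rewrite scalerA // mulrC.
Qed.

(** Both classes equal [[K] - [Z, eZ]]: [W], [K] and [Z] are built from [e] alone, and [eZ] is fixed
    before extending it together with [e] or [e'] to [W]. *)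
Lemma nh_class_unique (X : cplx R) (PX PX' : in_P n X) (s t : mset S)
    (e : null_homotopy X (sval s)) (e' : null_homotopy X (sval t)) :
  nh_class PX e = nh_class PX' e'.
Proof.
have PW := in_P_cover (sval s) n_ge1 PX; have PZ := in_P_syz e n_ge1 PX.
have PK := in_P_koszul (sval s) n_ge1 PX; have PY := in_P_disks n_ge1 PX.
have exW := cover_exact e.
have torW : torsion_homology S (cover X (sval s)).
  apply: dsum_torsion; first exact/acyclic_torsion/disks_acyclic.
  exact: nh_torsion (koszul_nh _ _).
have [r [eZ _]] := nh_exists PZ (ses_torsion exW torW (nh_torsion e)).
have classW (u : mset S) (a : null_homotopy (cover X (sval s)) (sval u)) :
    nh_class PW a = nh_class PK (koszul_nh (X 0) (sval s)).
  exact: (nh_class_dsum_koszul PY PK PW (disks_acyclic X)).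
have [u [a]] := nh_class_extend PZ PW PX eZ e exW.
have [v [b]] := nh_class_extend PZ PW PX' eZ e' exW.
by rewrite !classW => -> /addrI.
Qed.

Lemma perf_on_nh_class (X : perf_on S n) : exists c : colim_G_T S n,
  exists (s : mset S) (e : null_homotopy (sval X) (sval s)), c = nh_class (svalP X).1 e.
Proof.
have [PX /loc_acyclic_torsion torX] := svalP X.
have [s [e _]] := nh_exists PX torX.
by exists (nh_class (svalP X).1 e), s, e.
Qed.

(** The inverse on generators; the choice of null-homotopy is harmless by [nh_class_unique]. *)
Definition to_colim (X : perf_on S n) : colim_G_T S n := sval (cid (perf_on_nh_class X)).

Lemma to_colimP (X : perf_on S n) : exists (s : mset S)
  (e : null_homotopy (sval X) (sval s)), to_colim X = nh_class (svalP X).1 e.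
Proof. exact: svalP (cid (perf_on_nh_class X)). Qed.

Lemma to_colimE (X : perf_on S n) PX (s : mset S) (e : null_homotopy (sval X) (sval s)) :
  to_colim X = nh_class PX e.
Proof. by have [t [a ->]] := to_colimP X; exact: nh_class_unique. Qed.

Fact to_colim_iso (X Y : perf_on S n) :
  cplx_class (sval X) = cplx_class (sval Y) -> to_colim X = to_colim Y.
Proof.
move=> /(cplx_classP _ (in_P_fg (svalP X).1))[u [v uv]].
have [s [e ->]] := to_colimP X.
have vK i : cancel (v i) (u i) by have [] := uv i.
rewrite (to_colimE (svalP Y).1 (compress e vK)).
apply: (nh_class_iso _ _ uv) => i x /=.
by have [-> _] := uv i.
Qed.

Fact to_colim_ses (X Y Z : perf_on S n) :
  cplx_ses (sval X) (sval Y) (sval Z) -> to_colim Y = to_colim X + to_colim Z.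
Proof.
move=> [f [g fg]]; have [s [e ->]] := to_colimP X; have [t [a ->]] := to_colimP Z.
have [u [b <-]] := nh_class_extend (svalP X).1 (svalP Y).1 (svalP Z).1 e a fg.
exact: to_colimE.
Qed.

Fact to_colim_acyclic (X : perf_on S n) : acyclic (sval X) -> to_colim X = 0.
Proof. by move=> aX; have [s [e ->]] := to_colimP X; exact: nh_class_acyclic. Qed.

Definition comparison_inv : {additive G_on S n -> colim_G_T S n} :=
  groth_lift to_colim_iso to_colim_ses to_colim_acyclic.

End Independence.

(** * Bijectivity of the comparison map *)

Lemma colim_ext (R : comPzRingType) (S : mulrClosed R) (F : mset S -> zmodType)
    (tr : forall s x : mset S, {additive F s -> F (msetM s x)}) (W : zmodType)
    (u v : {additive colim tr -> W}) :
  (forall s a, u (colim_in tr s a) = v (colim_in tr s a)) -> u =1 v.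
Proof.
move=> uv z; have [x <-] := ab_proj_surj z.
apply: (@freeab_ext _ W (u \o ab_proj (colim_rel tr)) (v \o ab_proj (colim_rel tr))).
by case=> s a; exact: uv.
Qed.

Theorem proposition1p8 (R : comPzRingType) (S : mulrClosed R) (n : option nat)
    (n_ge1 : leq_oo 1 n) :
  bijective (G_comparison S n).
Proof.
exists (comparison_inv S n_ge1).
  apply: (@colim_ext _ _ _ _ _ (comparison_inv S n_ge1 \o G_comparison S n) idfun) => s.
  apply: (@groth_ext _ _ _ _ _ _
    (comparison_inv S n_ge1 \o G_comparison S n \o colim_in (G_T_tr n) s)
    (colim_in (G_T_tr n) s)) => X.
  rewrite [LHS](congr1 (comparison_inv S n_ge1) (G_comparisonE X)).
  rewrite [LHS]groth_liftE [RHS]nh_class_dg.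
  (* The module comes back with a possibly different [e], but with the same class by
     independence. *)
  exact: (to_colimE n_ge1 (X := forget_perf X)).
apply: (@groth_ext _ _ _ _ _ _ (G_comparison S n \o comparison_inv S n_ge1) idfun) => X.
have invX : comparison_inv S n_ge1 (G_on_class X) = to_colim X by exact: groth_liftE.
rewrite [LHS](congr1 (G_comparison S n) invX).
have [s [e ->]] := to_colimP X.
(* Forgetting [e] returns the complex [X] itself; only the membership proofs may differ. *)
by rewrite /nh_class G_comparisonE; exact: groth_class_eq.
Qed.
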